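(* Let $(A,\mathfrak m)$ be a Noetherian local ring, let $M$ be a finitely generated $A$-module and let $I$ be a proper ideal in $A$. Then: (1) if $\operatorname{projdim}_A H_i(I,M)$ is finite for all $i$, then $\operatorname{projdim}_A M$ is finite; (2) if $\operatorname{injdim}_A H_i(I,M)$ is finite for all $i$, then $\operatorname{injdim}_A M$ is finite.
   Context: $H_i(I,M)=H_i(\mathbf u,M)$ is the $i$-th Koszul homology module with coefficients in $M$ of a minimal generating set $\mathbf u=u_1,\dots,u_m$ of $I$ (independent, up to isomorphism, of the choice). The zero module is regarded as having finite projective and injective dimension. *)

(* Defs.v *)
From HB Require Import structures.
From mathcomp Require Import all_boot all_order all_algebra ring_quotient.
From mathcomp Require Import boolp.

Set Implicit Arguments.
Unset Strict Implicit.
Unset Printing Implicit Defensive.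

Import GRing.Theory.
Local Open Scope ring_scope.
Local Open Scope quotient_scope.

(* Sets of elements are boolean predicates; with the choice axioms of boolp
   (see asbool) every Prop-valued predicate is of this form.
   [idealr_closed I] is MathComp's notion of proper ideal; arbitrary ideals are
   the submodules of the regular module A^o. *)

Section Rings.
Variable A : comNzRingType.

Definition ideal (I : {pred A}) : Prop := submod_closed (I : {pred A^o}).

Definition maximal_ideal (I : {pred A}) : Prop :=
  idealr_closed I /\
  forall J : {pred A}, idealr_closed J -> {subset I <= J} -> I =i J.

Definition local_ring (mm : {pred A}) : Prop :=
  maximal_ideal mm /\ forall J : {pred A}, maximal_ideal J -> J =i mm.

Definition generated_by (I : {pred A}) (m : nat) (u : 'I_m -> A)
    (s : {set 'I_m}) : Prop :=
  forall x, x \in I <-> exists c : 'I_m -> A, x = \sum_(k in s) c k * u k.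

Definition noetherian : Prop :=
  forall I : {pred A}, ideal I ->
    exists (m : nat) (u : 'I_m -> A), generated_by I u setT.

Definition minimal_generating (I : {pred A}) (m : nat) (u : 'I_m -> A) : Prop :=
  generated_by I u setT /\
  forall s : {set 'I_m}, s \proper setT -> ~ generated_by I u s.

End Rings.

Section Modules.
Variable A : comNzRingType.

Definition fin_gen_module (M : lmodType A) : Prop :=
  exists (n : nat) (x : 'I_n -> M),
    forall y : M, exists c : 'I_n -> A, y = \sum_k c k *: x k.

Definition surjective (U V : lmodType A) (f : {linear U -> V}) : Prop :=
  forall y, exists x, f x = y.

Definition exact_at (U V W : lmodType A)
    (f : {linear U -> V}) (g : {linear V -> W}) : Prop :=
  forall y, g y = 0 <-> exists x, f x = y.

Definition projective (P : lmodType A) : Prop :=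
  forall (V W : lmodType A) (g : {linear V -> W}) (f : {linear P -> W}),
    surjective g -> exists h : {linear P -> V}, forall x, g (h x) = f x.

Definition injective_module (E : lmodType A) : Prop :=
  forall (V W : lmodType A) (g : {linear V -> W}) (f : {linear V -> E}),
    injective g -> exists h : {linear W -> E}, forall x, h (g x) = f x.

Definition projective_resolution (M : lmodType A) (P : nat -> lmodType A)
    (d : forall i, {linear P i.+1 -> P i}) (e : {linear P 0%N -> M}) : Prop :=
  [/\ forall i, projective (P i), surjective e, exact_at (d 0%N) e
    & forall i, exact_at (d i.+1) (d i)].

Definition injective_resolution (M : lmodType A) (E : nat -> lmodType A)
    (d : forall i, {linear E i -> E i.+1}) (e : {linear M -> E 0%N}) : Prop :=
  [/\ forall i, injective_module (E i), injective e, exact_at e (d 0%N)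
    & forall i, exact_at (d i) (d i.+1)].

Definition projdim_le (M : lmodType A) (n : nat) : Prop :=
  exists (P : nat -> lmodType A) (d : forall i, {linear P i.+1 -> P i})
         (e : {linear P 0%N -> M}),
    projective_resolution d e /\ forall i, (n < i)%N -> forall x : P i, x = 0.

Definition injdim_le (M : lmodType A) (n : nat) : Prop :=
  exists (E : nat -> lmodType A) (d : forall i, {linear E i -> E i.+1})
         (e : {linear M -> E 0%N}),
    injective_resolution d e /\ forall i, (n < i)%N -> forall x : E i, x = 0.

Definition finite_projdim (M : lmodType A) : Prop := exists n, projdim_le M n.
Definition finite_injdim (M : lmodType A) : Prop := exists n, injdim_le M n.

End Modules.

Section QuotientModule.
Variables (A : comNzRingType) (V : lmodType A).
Variables (B : {pred V}) (subB : submod_closed B).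

Definition submod_pred & submod_closed B : {pred V} := B.
HB.instance Definition _ :=
  GRing.isZmodClosed.Build V (submod_pred subB) (GRing.submod_closedB subB).

Definition quot_module := Quotient.quot (submod_pred subB).
HB.instance Definition _ := GRing.Zmodule.on quot_module.

Definition quot_pi (v : V) : quot_module :=
  \pi_(Quotient.quot (submod_pred subB)) v.

Definition quot_scale (a : A) (x : quot_module) : quot_module :=
  quot_pi (a *: repr x).

Fact quot_piD v w : quot_pi (v + w) = quot_pi v + quot_pi w.
Proof. exact: (raddfD (\pi_(Quotient.quot (submod_pred subB)))). Qed.

Fact quot_piK (x : quot_module) : quot_pi (repr x) = x.
Proof. exact: reprK. Qed.

Fact quot_pi_eq v w : (quot_pi v == quot_pi w) = (v - w \in B).
Proof. by rewrite -(Quotient.idealrBE (submod_pred subB)). Qed.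

Fact quot_piZ a v : quot_pi (a *: v) = quot_scale a (quot_pi v).
Proof.
apply/eqP; rewrite quot_pi_eq -scalerBr.
apply: (GRing.subsemimod_closedZ (GRing.submod_closed_semi subB)).
by rewrite -quot_pi_eq quot_piK.
Qed.

Fact quot_scaleA a b x : quot_scale a (quot_scale b x) = quot_scale (a * b) x.
Proof. by rewrite -[x]quot_piK -!quot_piZ scalerA. Qed.

Fact quot_scale1 : left_id 1 quot_scale.
Proof. by move=> x; rewrite -[x]quot_piK -quot_piZ scale1r. Qed.

Fact quot_scaleDr : right_distributive quot_scale +%R.
Proof.
move=> a x y; rewrite -[x]quot_piK -[y]quot_piK.
by rewrite -quot_piD -!quot_piZ -quot_piD scalerDr.
Qed.

Fact quot_scaleDl x : {morph quot_scale^~ x : a b / a + b}.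
Proof. by move=> a b; rewrite -[x]quot_piK -!quot_piZ -quot_piD scalerDl. Qed.

HB.instance Definition _ := GRing.Zmodule_isLmodule.Build A quot_module
  quot_scaleA quot_scale1 quot_scaleDr quot_scaleDl.

End QuotientModule.

Section Homology.
Variables (A : comNzRingType) (U V W : lmodType A).
Variables (f : {linear U -> V}) (g : {linear V -> W}).

Definition ker_pred : {pred V} := fun y => g y == 0.

Fact ker_submod_closed : submod_closed ker_pred.
Proof.
split=> [|a x y]; rewrite !unfold_in ?linear0 // => /eqP gx /eqP gy.
by rewrite linearP gx gy scaler0 addr0.
Qed.
HB.instance Definition _ :=
  GRing.isSubmodClosed.Build A V ker_pred ker_submod_closed.

Definition ker_module := {y : V | ker_pred y}.
HB.instance Definition _ := SubChoice.on ker_module.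
HB.instance Definition _ := [SubChoice_isSubLmodule of ker_module by <:].

Definition boundary_pred : {pred ker_module} :=
  fun y => `[< exists x, f x = val y >].

Fact boundary_submod_closed : submod_closed boundary_pred.
Proof.
split=> [|a x y]; rewrite !unfold_in; first by apply/asboolP; exists 0; rewrite !linear0.
move=> /asboolP[x' fx] /asboolP[y' fy]; apply/asboolP; exists (a *: x' + y').
by rewrite !linearP fx fy.
Qed.

(* ker g modulo im f; elements of im f outside ker g, if any, play no role. *)
Definition homology : lmodType A := quot_module boundary_submod_closed.

End Homology.

Section Koszul.
Variables (A : comNzRingType) (m : nat) (u : 'I_m -> A) (M : lmodType A).

(* The exterior power of degree i of A^m tensored with M: the family
   (x_S), indexed by the i-element subsets S = {k_1 < ... < k_i} of 'I_m,
   stands for \sum_S e_{k_1} /\ ... /\ e_{k_i} (x) x_S. *)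
Definition koszul (i : nat) := {ffun {S : {set 'I_m} | #|S| == i} -> M}.
HB.instance Definition _ i := GRing.Lmodule.on (koszul i).

Definition koszul_coef i (x : koszul i) (S : {set 'I_m}) : M :=
  oapp x 0 (insub S).

(* From d (e_{k_1} /\ ... /\ e_{k_i}) =
     \sum_r (-1)^(r-1) u_{k_r} e_{k_1} /\ .. omit e_{k_r} .. /\ e_{k_i},
   the coefficient of d x at T collects the sets k |: T with k \notin T.
   It is defined between all degrees i and j, but vanishes unless i = j.+1;
   in particular the map from degree 0 to 0.-1 = 0 is zero. *)
Definition koszul_diff i j (x : koszul i) : koszul j :=
  [ffun T : {T : {set 'I_m} | #|T| == j} => \sum_(k | k \notin val T)
    ((-1) ^+ #|[set l in val T | (l < k)%N]| * u k)
      *: koszul_coef x (k |: val T)].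

Fact koszul_coefP i (a : A) (x y : koszul i) S :
  koszul_coef (a *: x + y) S = a *: koszul_coef x S + koszul_coef y S.
Proof.
rewrite /koszul_coef; case: insubP => [s _ _|_] /=; last by rewrite scaler0 addr0.
by rewrite !ffunE.
Qed.

Fact koszul_diff_is_linear i j : linear (@koszul_diff i j).
Proof.
move=> a x y; apply/ffunP=> T; rewrite !ffunE scaler_sumr -big_split /=.
apply: eq_bigr => k _.
by rewrite koszul_coefP scalerDr !scalerA [a * _]mulrC.
Qed.
HB.instance Definition _ i j :=
  GRing.isLinear.Build A (koszul i) (koszul j) *:%R (@koszul_diff i j)
    (@koszul_diff_is_linear i j).

Lemma koszul_diff_diff i (x : koszul i.+2) :
  koszul_diff i (koszul_diff i.+1 x) = 0.
Proof.
apply/ffunP=> -[T cT]; rewrite !ffunE /=.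
pose s (k : 'I_m) (S : {set 'I_m}) : A := (-1) ^+ #|[set l in S | (l < k)%N]|.
pose F k l := (s k T * s l T * (u k * u l)) *: koszul_coef x (l |: (k |: T)).
have FC k l : F k l = F l k.
  by rewrite /F setUCA (mulrC (s k T)) (mulrC (u k)).
transitivity (\sum_(k | k \notin T) \sum_(l | l \notin T)
   ((if (k < l)%N then - F k l else 0) + (if (l < k)%N then F l k else 0))).
  apply: eq_bigr => k kT.
  have cS : #|k |: T| == i.+1 by rewrite cardsU1 kT (eqP cT).
  rewrite /koszul_coef insubT /= ffunE /= scaler_sumr.
  rewrite big_mkcond [RHS]big_mkcond /=; apply: eq_bigr => l _.
  rewrite !inE negb_or; case: (ltngtP k l) => [kl|lk|/val_inj ->]; last first.
  - by rewrite eqxx addr0 if_same.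
  - have -> : l != k by rewrite -val_eqE /= neq_ltn lk.
    case: (boolP (l \notin T)) => //= lT; rewrite add0r FC /F scalerA /s; congr (_ *: _).
    suff -> : [set j in k |: T | (j < l)%N] = [set j in T | (j < l)%N].
      by rewrite !mulrA; congr (_ * _); rewrite mulrAC.
    by apply/setP => j; rewrite !inE; case: eqP => // ->; rewrite ltnNge (ltnW lk) /= andbF.
  have -> : l != k by rewrite -val_eqE /= neq_ltn kl orbT.
  case: (boolP (l \notin T)) => //= lT; rewrite addr0 /F scalerA -scaleNr /s; congr (_ *: _).
  suff -> : [set j in k |: T | (j < l)%N] = k |: [set j in T | (j < l)%N].
    rewrite cardsU1 !inE (negPf kT) /= exprS mulN1r !mulNr mulrN !mulrA.
    by congr (- (_ * _)); rewrite mulrAC.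
  by apply/setP => j; rewrite !inE; case: eqP => // ->; rewrite kl.
under eq_bigr do rewrite big_split; rewrite big_split /= [X in _ + X]exchange_big.
rewrite -big_split big1 //= => k _; rewrite -big_split big1 //= => l _.
by case: ifP; rewrite ?addNr ?addr0.
Qed.

Definition koszul_homology (i : nat) : lmodType A :=
  homology (@koszul_diff i.+1 i : {linear koszul i.+1 -> koszul i})
           (@koszul_diff i i.-1 : {linear koszul i -> koszul i.-1}).

End Koszul.

(* Main.v *)
(* Let F be a resolution of k = A/mm by finite free modules, given by matrices,
   so that Tor(k, N) and Ext(k, N) are the homologies of the matrices of F and
   of their transposes acting on families of elements of N. Multiplication by
   each u_k in I is null-homotopic on F; hence a cycle of F (x) M which becomes
   a boundary in the total complex of F (x) K(u; M) is already a boundary in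
   F (x) M. If all H_i(u; M) have finite projective dimension, then F (x) H_i
   is exact in high degrees, and so every cycle of high degree becomes a
   boundary in the total complex: Tor_j(k, M) = 0 for large j. Dually for Ext.

   Vanishing of Tor makes a high syzygy of M free, by Nakayama. Vanishing of
   Ext(k, M) propagates to all Ext(A/J, M) by noetherian induction on J: for x
   in mm but not in J, either J : x and J + (x) are both larger than J, or x is
   regular on A/J, and then Ext(A/J, M) = x Ext(A/J, M) vanishes by Nakayama.
   By Baer's criterion, a high cosyzygy of M is injective. *)

Require Import Defs.
From HB Require Import structures.
From mathcomp Require Import all_boot all_order all_algebra ring_quotient.
From mathcomp Require Import boolp functions zify.
From mathcomp Require classical_sets.

Set Implicit Arguments.
Unset Strict Implicit.
Unset Printing Implicit Defensive.

Import GRing.Theory.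
Local Open Scope ring_scope.

(** * Complexes of matrices acting on modules *)

(** With matrices neither tensor products nor Hom modules have to be formed, and one descent theorem
    serves both halves: Tor reads the resolution in decreasing degree, Ext uses its transposes. The
    descent works because adjoining an index r to a Koszul complex forms the cone of multiplication
    by u_r. When that map is null-homotopic the cone splits, so a cycle of the smaller complex that
    bounds in the cone already bounds. As H_i vanishes for i > m, finitely many bounds on the degree
    have to be combined. The halves differ at the end. Freeness of a finitely generated module is
    tested by k alone, injectivity by all ideals. Moreover cosyzygies need not be finitely
    generated, so Nakayama has to be applied to homology computed from families in M, in high
    degree, and the result carried over to a cosyzygy in degree 1. *)

Section Act.
Variable A : comNzRingType.
Implicit Types (N : lmodType A).

Definition act p q (D : 'M[A]_(p, q)) N (y : {ffun 'I_q -> N}) :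
  {ffun 'I_p -> N} := [ffun a => \sum_b D a b *: y b].

Fact act_is_linear p q (D : 'M[A]_(p, q)) N : linear (@act p q D N).
Proof.
move=> a y z; apply/ffunP=> i; rewrite !ffunE scaler_sumr -big_split /=.
by apply: eq_bigr => j _; rewrite !ffunE scalerDr !scalerA mulrC.
Qed.
HB.instance Definition _ p q (D : 'M[A]_(p, q)) N :=
  GRing.isLinear.Build A {ffun 'I_q -> N} {ffun 'I_p -> N} *:%R
    (@act p q D N) (@act_is_linear p q D N).

Lemma actM p q r (D : 'M[A]_(p, q)) (E : 'M_(q, r)) N (y : {ffun 'I_r -> N}) :
  act (D *m E) y = act D (act E y).
Proof.
apply/ffunP=> i; rewrite !ffunE.
transitivity (\sum_b \sum_c (D i c * E c b) *: y b).
  by apply: eq_bigr => b _; rewrite mxE scaler_suml.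
rewrite exchange_big /=; apply: eq_bigr => c _.
by rewrite ffunE scaler_sumr; apply: eq_bigr => b _; rewrite scalerA.
Qed.

Lemma act0 p q N (y : {ffun 'I_q -> N}) : act (0 : 'M_(p, q)) y = 0.
Proof.
by apply/ffunP=> i; rewrite !ffunE big1 // => j _; rewrite mxE scale0r.
Qed.

Lemma actD p q (D E : 'M[A]_(p, q)) N (y : {ffun 'I_q -> N}) :
  act (D + E) y = act D y + act E y.
Proof.
apply/ffunP=> i; rewrite !ffunE -big_split; apply: eq_bigr => j _ /=.
by rewrite mxE scalerDl.
Qed.

Lemma actN p q (D : 'M[A]_(p, q)) N (y : {ffun 'I_q -> N}) :
  act (- D) y = - act D y.
Proof. by apply/eqP; rewrite -addr_eq0 -actD addNr act0. Qed.

Lemma act_scalar p (x : A) N (y : {ffun 'I_p -> N}) : act x%:M y = x *: y.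
Proof.
apply/ffunP=> i; rewrite !ffunE (bigD1 i) //= mxE eqxx big1 ?addr0 // => j ji.
by rewrite mxE eq_sym (negPf ji) scale0r.
Qed.

Lemma act_comp0 p q r (D : 'M[A]_(p, q)) (E : 'M_(q, r)) N
  (y : {ffun 'I_r -> N}) : D *m E = 0 -> act D (act E y) = 0.
Proof. by move=> DE; rewrite -actM DE act0. Qed.

Definition fmap q (N N' : lmodType A) (f : N -> N') (y : {ffun 'I_q -> N}) :
  {ffun 'I_q -> N'} := [ffun a => f (y a)].

Fact fmap_is_linear q (N N' : lmodType A) (f : {linear N -> N'}) :
  linear (@fmap q N N' f).
Proof. by move=> a y z; apply/ffunP=> i; rewrite !ffunE linearP. Qed.
HB.instance Definition _ q (N N' : lmodType A) (f : {linear N -> N'}) :=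
  GRing.isLinear.Build A {ffun 'I_q -> N} {ffun 'I_q -> N'} *:%R
    (@fmap q N N' f) (@fmap_is_linear q N N' f).

Lemma act_fmap p q (D : 'M[A]_(p, q)) (N N' : lmodType A)
    (f : {linear N -> N'}) y : act D (fmap f y) = fmap f (act D y).
Proof.
apply/ffunP=> i; rewrite !ffunE linear_sum.
by apply: eq_bigr => j _; rewrite !ffunE linearZ.
Qed.

Lemma fmap_comp0 q (U V W : lmodType A) (f : {linear U -> V})
  (g : {linear V -> W}) (y : {ffun 'I_q -> U}) :
  (forall x, g (f x) = 0) -> fmap g (fmap f y) = 0.
Proof. by move=> gf; apply/ffunP=> i; rewrite !ffunE gf. Qed.

Lemma fmap_inj q (N N' : lmodType A) (f : {linear N -> N'}) :
  injective f -> injective (@fmap q N N' f).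
Proof.
by move=> fI y z /ffunP E; apply/ffunP=> i; apply: fI; move: (E i); rewrite !ffunE.
Qed.

Lemma ffun_choice q (T : Type) (P : 'I_q -> T -> Prop) :
  (forall a, exists z, P a z) -> exists z : {ffun 'I_q -> T}, forall a, P a (z a).
Proof. by move=> /choice[z zP]; exists [ffun a => z a] => a; rewrite ffunE. Qed.

Lemma fmap_lift q (U V : lmodType A) (f : {linear U -> V}) (y : {ffun 'I_q -> V}) :
  (forall a, exists x, f x = y a) -> exists z, fmap f z = y.
Proof.
by move=> /ffun_choice[z zP]; exists z; apply/ffunP=> a; rewrite ffunE.
Qed.

(* Multiplication by x is surjective on the homology of
   N^r -> N^q -> N^p; for x = 0 this is exactness, see [mx_exactP]. *)
Definition div_exact (x : A) p q r (E : 'M[A]_(q, r)) (D : 'M[A]_(p, q)) N : Prop :=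
  forall y : {ffun 'I_q -> N}, act D y = 0 ->
    exists (y' : {ffun 'I_q -> N}) (z : {ffun 'I_r -> N}),
      act D y' = 0 /\ y = x *: y' + act E z.

Definition mx_exact p q r (E : 'M[A]_(q, r)) (D : 'M[A]_(p, q)) N : Prop :=
  forall y : {ffun 'I_q -> N}, act D y = 0 -> exists z, y = act E z.

Lemma mx_exactP p q r (E : 'M[A]_(q, r)) (D : 'M[A]_(p, q)) N :
  mx_exact E D N <-> div_exact 0 E D N.
Proof.
split=> ex y /ex; last by case=> y' [z [_ ->]]; exists z; rewrite scale0r add0r.
by case=> z ->; exists 0, z; rewrite linear0 scale0r add0r.
Qed.

Section ShortExact.
Variables (N' P N : lmodType A) (f : {linear N' -> P}) (g : {linear P -> N}).
Hypotheses (fI : injective f) (gS : surjective g) (fg : exact_at f g).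
Variables (n3 n2 n1 n0 : nat).
Variables (E2 : 'M[A]_(n2, n3)) (E1 : 'M[A]_(n1, n2)) (E0 : 'M[A]_(n0, n1)).

Lemma exact_comp0 x : g (f x) = 0.
Proof. by apply/fg; exists x. Qed.

Lemma exact_fmap q (y : {ffun 'I_q -> P}) : fmap g y = 0 -> exists z, fmap f z = y.
Proof.
by move=> /ffunP gy; apply: fmap_lift => a; apply/fg; move: (gy a); rewrite !ffunE.
Qed.

(** Connecting map of the long exact sequence: exactness of [P] makes the homology of [N] one place
    earlier surject onto that of [N'], and a linear surjection preserves divisibility by [x]. *)
Lemma div_exact_sub (x : A) : E1 *m E2 = 0 -> E0 *m E1 = 0 ->
  div_exact x E2 E1 N -> mx_exact E1 E0 P -> div_exact x E1 E0 N'.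
Proof.
move=> E12 E01 exN exP y y0.
have [p yp] : exists p, fmap f y = act E1 p by apply: exP; rewrite act_fmap y0 linear0.
have gp0 : act E1 (fmap g p) = 0 by rewrite act_fmap -yp fmap_comp0 //; apply: exact_comp0.
have [q' [z' [q0 gp]]] := exN _ gp0.
have [q qE] : exists q, fmap g q = q' by apply: fmap_lift => a; apply: gS.
have [z zE] : exists z, fmap g z = z' by apply: fmap_lift => a; apply: gS.
have [y' y'E] : exists y', fmap f y' = act E1 q.
  by apply: exact_fmap; rewrite -act_fmap qE.
have [n nE] : exists n, fmap f n = p - (x *: q + act E2 z).
  apply: exact_fmap; rewrite linearB linearD linearZ /= -act_fmap.
  by rewrite gp -qE -zE subrr.
exists y', n; split.
  by apply: (fmap_inj fI); rewrite -act_fmap y'E linear0 act_comp0.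
apply: (fmap_inj fI); rewrite yp linearD linearZ /= y'E -act_fmap nE.
by rewrite linearB linearD linearZ /= act_comp0 // addr0 addrC subrK.
Qed.

(** The same long exact sequence, read at [N]: its homology sits between that of [P] and that of
    [N'] one place later. *)
Lemma mx_exact_quot : E0 *m E1 = 0 ->
  mx_exact E1 E0 N' -> mx_exact E2 E1 P -> mx_exact E2 E1 N.
Proof.
move=> E01 exN' exP y y0.
have [p pE] : exists p, fmap g p = y by apply: fmap_lift => a; apply: gS.
have [n nE] : exists n, fmap f n = act E1 p.
  by apply: exact_fmap; rewrite -act_fmap pE.
have [|z zE] := exN' n.
  by apply: (fmap_inj fI); rewrite -act_fmap nE linear0 act_comp0.
have [|w wE] := exP (p - fmap f z); first by rewrite linearB /= act_fmap -zE nE subrr.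
exists (fmap g w); rewrite act_fmap -wE linearB /= pE fmap_comp0 ?subr0 //.
exact: exact_comp0.
Qed.
End ShortExact.
End Act.

(** * Descent along the Koszul complex *)

Section HomologyLift.
Variable A : comNzRingType.

Fact quot_pi_is_linear (V : lmodType A) (B : {pred V}) (subB : submod_closed B) :
  linear (@quot_pi A V B subB).
Proof. by move=> a x y; rewrite quot_piD quot_piZ. Qed.
HB.instance Definition _ (V : lmodType A) (B : {pred V}) (subB : submod_closed B) :=
  GRing.isLinear.Build A V (quot_module subB) *:%R (@quot_pi A V B subB)
    (@quot_pi_is_linear V B subB).

Lemma quot_pi_eq0 (V : lmodType A) (B : {pred V}) (subB : submod_closed B) v :
  quot_pi subB v = 0 <-> v \in B.
Proof.
have := quot_pi_eq subB v 0; rewrite subr0 (linear0 (quot_pi subB)) => <-.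
by split=> [->|/eqP].
Qed.

(** Carries exactness over a homology module back to representatives: the class of [y] is a
    boundary, and lifting that boundary leaves an error in the image of [f]. *)
Lemma homology_lift (U V W : lmodType A) (f : {linear U -> V})
    (g : {linear V -> W}) p q r (E : 'M[A]_(q, r)) (D : 'M[A]_(p, q)) :
  mx_exact E D (homology f g) ->
  forall y : {ffun 'I_q -> V}, fmap g y = 0 -> act D y = 0 ->
  exists (v : {ffun 'I_r -> V}) (h : {ffun 'I_q -> U}),
    fmap g v = 0 /\ y = act E v + fmap f h.
Proof.
move=> ex y /ffunP gy Dy.
have [vl vlE] : exists vl : {linear ker_module g -> V}, forall x, vl x = val x.
  by exists val.
have [pi piE] : exists pi : {linear ker_module g -> homology f g},
    forall x, pi x = quot_pi (boundary_submod_closed f g) x.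
  by exists (quot_pi (boundary_submod_closed f g)).
have vlI : injective vl by move=> a b; rewrite !vlE; apply: val_inj.
have gvl x : g (vl x) = 0 by apply/eqP; rewrite vlE; exact: (valP x).
have [k kE] : exists k, fmap vl k = y.
  apply: fmap_lift => a; have ga : ker_pred g (y a).
    by apply/eqP; move: (gy a); rewrite !ffunE.
  by exists (Sub (y a) ga); rewrite vlE; apply: SubK.
have [|zb zE] := ex (fmap pi k).
  rewrite act_fmap; have -> : act D k = 0.
    by apply: (fmap_inj vlI); rewrite -act_fmap kE Dy linear0.
  exact: linear0.
have [z zz] : exists z, fmap pi z = zb.
  by apply: fmap_lift => a; exists (repr (zb a)); rewrite piE; apply: quot_piK.
have [h hE] : exists h, fmap f h = fmap vl (k - act E z).
  apply: fmap_lift => a; rewrite ffunE vlE.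
  apply/asboolP/(quot_pi_eq0 (boundary_submod_closed f g)).
  have /ffunP/(_ a) : fmap pi (k - act E z) = 0.
    by rewrite linearB /= zE -zz act_fmap subrr.
  by rewrite -piE !ffunE.
exists (fmap vl z), h; split; first exact: fmap_comp0.
by rewrite hE linearB /= kE act_fmap addrC subrK.
Qed.
End HomologyLift.

Section KoszulDescent.
Variables (A : comNzRingType) (m : nat) (u : 'I_m -> A) (M : lmodType A).
Notation dK i := (@koszul_diff A m u M i.+1 i : {linear koszul m M i.+1 -> koszul m M i}).
Variables (p : nat -> nat) (d : forall i, 'M[A]_(p i.+1, p i)).
Hypothesis dd0 : forall i, d i.+1 *m d i = 0.
Variable s : forall (k : 'I_m) i, 'M[A]_(p i, p i.+1).
(** The range [i < m] suffices for the elimination, because every set [T] used there misses an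
    index. It allows [d] to run backwards through a resolution that stops in degree 0. *)
Hypothesis homotopy : forall k i, (i < m)%N ->
  d i *m s k i + s k i.+1 *m d i.+1 = (u k)%:M.
Hypothesis exH : forall i, mx_exact (d i) (d i.+1) (koszul_homology u M i).

Let cycle i (g : {ffun 'I_(p i.+1) -> koszul m M i}) :=
  act (d i.+1) g = 0 /\ fmap (@koszul_diff A m u M i i.-1) g = 0.

(** One step of a zigzag in the double complex: [act (d i.+1) h] is again a Koszul cycle, since its
    Koszul boundary is [act (d i.+1)] of [g - act (d i) w]. The sigma type makes the step iterable
    by [fix]. *)
Lemma koszul_descent_step i (g : {g | cycle (i := i) g}) :
  {w : {ffun 'I_(p i) -> koszul m M i} & {g' : {g' | cycle (i := i.+1) g'} &
   {h : {ffun 'I_(p i.+1) -> koszul m M i.+1} |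
      [/\ sval g = act (d i) w + fmap (dK i) h,
          fmap (@koszul_diff A m u M i i.-1) w = 0 & sval g' = act (d i.+1) h]}}}.
Proof.
case: g => g [dg kg] /=.
have /cid[v /cid[h [kv gE]]] := homology_lift (@exH i) kg dg.
have cg : cycle (i := i.+1) (act (d i.+1) h).
  split; first exact: act_comp0.
  rewrite /= -act_fmap; have : act (d i.+1) (g - act (d i) v) = 0.
    by rewrite linearB /= dg act_comp0 // subr0.
  by rewrite gE addrC addKr.
by exists v, (exist _ _ cg), h.
Qed.

Lemma koszul_descent (z : {ffun 'I_(p 1) -> M}) : act (d 1) z = 0 ->
  exists w : forall i, {ffun 'I_(p i) -> koszul m M i},
    act (d 0) (w 0) + [ffun a => [ffun=> z a]] = fmap (dK 0) (w 1%N) /\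
    forall i, act (d i.+1) (w i.+1) = fmap (dK i.+1) (w i.+2).
Proof.
move=> dz; pose g0 : {ffun 'I_(p 1) -> koszul m M 0} := [ffun a => [ffun=> z a]].
have cg0 : cycle (i := 0) g0.
  split.
    apply/ffunP=> a; apply/ffunP=> S; move/ffunP: dz => /(_ a).
    rewrite !ffunE sum_ffunE => dz; rewrite -[RHS]dz.
    by apply: eq_bigr => j _; rewrite !ffunE.
  (* The differential from degree 0 to degree 0 reads coefficients at the nonempty sets [k |: S],
     which are zero. *)
  apply/ffunP=> a; apply/ffunP=> S; rewrite !ffunE big1 // => k kS.
  rewrite /koszul_coef insubF /= ?scaler0 //.
  by rewrite cardsU1 kS.
pose G := fix G i : {g | cycle (i := i) g} :=
  if i is j.+1 then projT1 (projT2 (koszul_descent_step (G j))) else exist _ g0 cg0.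
pose v i := projT1 (koszul_descent_step (G i)).
pose h i := sval (projT2 (projT2 (koszul_descent_step (G i)))).
have H i : [/\ sval (G i) = act (d i) (v i) + fmap (dK i) (h i),
          fmap (@koszul_diff A m u M i i.-1) (v i) = 0 &
          sval (G i.+1) = act (d i.+1) (h i)].
  exact: (svalP (projT2 (projT2 (koszul_descent_step (G i))))).
(* Substituting [G i.+1 = act (d i.+1) (h i)] into the decomposition of [G i.+1] moves [v i.+1] to
   the left. Being Koszul cycles, the [v] do not affect the right-hand sides. *)
exists (fun i => match i return {ffun 'I_(p i) -> koszul m M i} with
  0 => - v 0 | j.+1 => h j - v j.+1 end); split.
  case: (H 0) => /= E _ _; case: (H 1%N) => _ /= E1 _.
  by rewrite linearB /= E1 subr0 linearN /= -/g0 E addKr.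
move=> i; case: (H i) => _ _ E; case: (H i.+1) => E1 _ _; case: (H i.+2) => _ /= E2 _.
by rewrite !linearB /= E2 subr0 -E E1 addrC addKr.
Qed.

Let sg (k : 'I_m) (T : {set 'I_m}) : A := (-1) ^+ #|[set l in T | (l < k)%N]|.

(* w bounds b in the total complex, on the part of the Koszul complex spanned
   by the indices below r. *)
Let eliminated r (b : forall i, {ffun 'I_(p i.+1) -> M})
    (w : forall i, {set 'I_m} -> {ffun 'I_(p i) -> M}) :=
  forall i (T : {set 'I_m}), #|T| = i -> (forall k, k \in T -> (k < r)%N) ->
  act (d i) (w i T) + b i =
  \sum_(k | (k \notin T) && (k < r)%N) (sg k T * u k) *: w i.+1 (k |: T).

(* The homotopy of u_r removes the index r, the largest one left, from the
   chain w; as r exceeds all elements of T, its Koszul sign is (-1)^|T|. *)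
Lemma koszul_eliminate (r : 'I_m) b w : (forall i, b i.+1 = 0) ->
  eliminated r.+1 b w ->
  eliminated r b (fun i T => w i T - (-1) ^+ i *: act (s r i) (w i.+1 (r |: T))).
Proof.
move=> b0 eq_w i T cT Tr.
have rT : r \notin T by apply/negP => /Tr; rewrite ltnn.
have crT : #|r |: T| = i.+1 by rewrite cardsU1 rT cT.
have im : (i < m)%N by rewrite -crT -[X in (_ <= X)%N](card_ord m) max_card.
have Tr1 k : k \in T -> (k < r.+1)%N by move=> /Tr/ltnW.
have rTr1 k : k \in r |: T -> (k < r.+1)%N by rewrite !inE => /predU1P[->|/Tr1].
have := eq_w i.+1 _ crT rTr1; rewrite b0 addr0 => dW.
have lt_split (k : 'I_m) : (k < r.+1)%N = (k == r) || (k < r)%N by rewrite ltnS leq_eqVlt.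
rewrite linearB linearZ /= addrAC (eq_w i T cT Tr1) (bigD1 r) /= ?rT ?ltnS ?leqnn //.
rewrite -actM -[d i *m _](addrK (s r i.+1 *m d i.+1)) homotopy // actD act_scalar.
rewrite -mulNmx actM dW linear_sum /= scalerDr scaler_sumr.
have -> : sg r T = (-1) ^+ i.
  rewrite /sg -cT; congr (_ ^+ #|pred_of_set _|); apply/setP => k; rewrite !inE.
  by apply: andb_idr => /Tr.
rewrite -scalerA addrAC opprD addrA subrr add0r addrC -sumrN.
rewrite [X in X + _](eq_bigl (fun k => (k \notin T) && (k < r)%N)); last first.
  move=> k; rewrite -andbA lt_split.
  by case: (eqVneq k r) => [->|_] /=; rewrite ?ltnn ?andbF ?andbT ?orbF.
rewrite [X in _ + X](eq_bigl (fun k => (k \notin T) && (k < r)%N)); last first.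
  move=> k; rewrite !inE lt_split.
  by case: (eqVneq k r) => [->|_] /=; rewrite ?ltnn ?andbF ?andbT ?orbF.
rewrite -big_split /=; apply: eq_bigr => k /andP[kT kr].
have -> : sg k (r |: T) = sg k T.
  rewrite /sg; congr (_ ^+ #|pred_of_set _|); apply/setP => l; rewrite !inE.
  by case: (eqVneq l r) => [->|_] /=; rewrite ?ltnNge ?(ltnW kr) ?andbF.
rewrite scalerBr setUCA; congr (_ + _).
rewrite actN [act _ (_ *: _)]linearZ /= exprS mulN1r scaleNr !scalerN !opprK.
by rewrite !scalerA mulrC.
Qed.

(** The total chain bounding [z] involves all m indices. Once every index is eliminated, only its
    component at the empty set remains, with an empty Koszul sum: it bounds [- z] in the complex [d]
    itself. *)
Lemma koszul_mx_exact : mx_exact (d 0) (d 1) M.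
Proof.
move=> z dz; have [w [w0 wS]] := koszul_descent dz.
pose b i := match i return {ffun 'I_(p i.+1) -> M} with 0 => z | _ => 0 end.
have [w' el0] : exists w', eliminated 0 b w'.
  pose wm i (T : {set 'I_m}) := [ffun a => koszul_coef (w i a) T].
  have elm : eliminated m b wm.
    move=> i T cT _.
    have [TT valTT] : exists TT : {T : {set 'I_m} | #|T| == i}, val TT = T.
      by exists (Sub T (introT eqP cT)).
    have coefT (x : koszul m M i) : koszul_coef x T = x TT.
      rewrite /koszul_coef; case: insubP => [TT' _ vT|]; last by rewrite cT eqxx.
      by congr (x _); apply: val_inj; rewrite vT valTT.
    have -> : \sum_(k | (k \notin T) && (k < m)%N)
        (sg k T * u k) *: wm i.+1 (k |: T) = [ffun a => fmap (dK i) (w i.+1) a TT].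
      apply/ffunP=> a; rewrite ffunE [fmap _ _ a]ffunE sum_ffunE [RHS]ffunE valTT.
      apply: eq_big => k; first by rewrite ltn_ord andbT.
      by rewrite !ffunE.
    case: i cT TT valTT coefT => [|i] cT TT valTT coefT; rewrite -?w0 -?wS.
      apply/ffunP=> a; rewrite !ffunE !sum_ffunE; congr (_ + _).
      by apply: eq_bigr => j _; rewrite !ffunE coefT.
    apply/ffunP=> a; rewrite addr0 !ffunE !sum_ffunE.
    by apply: eq_bigr => j _; rewrite !ffunE coefT.
  (* Indices are removed from the top; after [k] rounds those below [m - k] remain. *)
  suff H k : exists w', eliminated (m - k) b w' by rewrite -(subnn m).
  elim: k => [|k [w' IH]]; first by exists wm; rewrite subn0.
  have [le|lt] := leqP m k.
    exists w'; move: IH; have /eqP -> : (m - k == 0)%N by [].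
    by have /eqP -> : (m - k.+1 == 0)%N by rewrite subn_eq0 leqW.
  have rm : (m - k.+1 < m)%N by rewrite ltn_subrL (leq_ltn_trans _ lt).
  move: IH; rewrite -(subnSK lt) => /(@koszul_eliminate (Ordinal rm) b w').
  by move=> H; eexists; apply: H.
exists (- w' 0 set0); rewrite linearN /=.
have := el0 0%N set0 (cards0 _); rewrite /= big_pred0 => [|k]; last by rewrite andbF.
by move=> /(_ _)/eqP; rewrite addrC addr_eq0 => /(_ _)/eqP; apply=> k; rewrite inE.
Qed.
End KoszulDescent.

(** * Noetherian and local rings *)

Section Span.
Variable A : comNzRingType.
Implicit Types N : lmodType A.

(** Recursion on the list exposes the coefficient of the head, which is how [noetherian_sub] and
    [nakayama] split off one generator. *)
Fixpoint span N (s : seq N) (y : N) : Prop :=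
  if s is x :: s' then exists a : A, span s' (y - a *: x) else y = 0.

Definition submodule N (B : N -> Prop) : Prop :=
  B 0 /\ forall a x y, B x -> B y -> B (a *: x + y).

Lemma submoduleB N (B : N -> Prop) x y : submodule B -> B x -> B y -> B (x - y).
Proof. by case=> _ BD Bx By; rewrite addrC -scaleN1r; apply: BD. Qed.

Lemma submoduleZ N (B : N -> Prop) a x : submodule B -> B x -> B (a *: x).
Proof. by case=> B0 BD Bx; rewrite -[_ *: _]addr0; apply: BD. Qed.

Lemma submodule_sum N (B : N -> Prop) (I : finType) (P : pred I) (c : I -> A)
    (x : I -> N) :
  submodule B -> (forall i, P i -> B (x i)) -> B (\sum_(i | P i) c i *: x i).
Proof.
case=> B0 BD Bx; apply: (big_rec B) => // i y Pi By.
by apply: BD => //; apply: Bx.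
Qed.

Lemma span_submodule N (s : seq N) : submodule (span s).
Proof.
elim: s => [|x s [IH0 IHD]]; first by split=> // a y z -> ->; rewrite scaler0 addr0.
split=> [|a y z [b yb] [c zc]]; first by exists 0; rewrite scale0r subr0.
exists (a * b + c); have := IHD a _ _ yb zc; congr (span s _).
by rewrite scalerBr scalerDl scalerA opprD addrACA.
Qed.

Lemma span_min N (s : seq N) (B : N -> Prop) : submodule B ->
  (forall x, x \in s -> B x) -> forall y, span s y -> B y.
Proof.
move=> subB; elim: s => [|x s IH] sB y /= => [->|[a]]; first by case: subB.
move=> /IH -/(_ (fun z zs => sB z (mem_behead (s := x :: s) zs))) H.
rewrite -(subrK (a *: x) y) addrC; case: (subB) => _; apply=> //.
by apply: sB; rewrite mem_head.
Qed.

Lemma span_mem N (s : seq N) x : x \in s -> span s x.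
Proof.
elim: s => //= y s IH; rewrite inE => /predU1P[->|/IH xs].
  by exists 1; rewrite scale1r subrr; case: (span_submodule s).
by exists 0; rewrite scale0r subr0.
Qed.

Lemma span_sub N (s t : seq N) : {subset s <= t} -> forall y, span s y -> span t y.
Proof. by move=> st; apply: span_min (span_submodule t) _ => x /st; apply: span_mem. Qed.

Lemma span_codom N n (x : 'I_n -> N) y :
  span (codom x) y <-> exists c : 'I_n -> A, y = \sum_k c k *: x k.
Proof.
split; last first.
  move=> [c ->]; apply: submodule_sum (span_submodule _) _ => i _.
  exact/span_mem/codom_f.
apply: (span_min (B := fun z => exists c : 'I_n -> A, z = \sum_k c k *: x k))
  => [|_ /codomP[i ->]].
- split; first by exists (fun=> 0); rewrite big1 // => k _; rewrite scale0r.
  move=> a _ _ [c ->] [c' ->]; exists (fun k => a * c k + c' k).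
  rewrite scaler_sumr -big_split; apply: eq_bigr => k _ /=.
  by rewrite scalerDl scalerA.
- exists (fun k => (k == i)%:R).
  rewrite (bigD1 i) //= eqxx scale1r big1 ?addr0 // => k /negPf ->.
  by rewrite scale0r.
Qed.

Lemma span_nth N (s : seq N) y :
  span s y <-> exists c : 'I_(size s) -> A, y = \sum_k c k *: s`_k.
Proof.
rewrite -span_codom; suff -> : codom (fun k : 'I_(size s) => s`_k) = s by [].
by rewrite codomE -[RHS](mkseq_nth 0) /mkseq -val_enum_ord -map_comp.
Qed.

Definition fin_gen_sub N (B : N -> Prop) : Prop :=
  exists s : seq N, (forall x, x \in s -> B x) /\ forall y, B y -> span s y.

Lemma fin_gen_moduleP N : fin_gen_module N <-> exists s : seq N, forall y, span s y.
Proof.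
split=> [[n [x H]]|[s H]].
  by exists (codom x) => y; apply/span_codom; apply: H.
by exists (size s), (fun k => s`_k) => y; apply/span_nth.
Qed.

Lemma generated_mem (J : {pred A}) q (v : 'I_q -> A) : generated_by J v setT ->
  forall k, v k \in J.
Proof.
move=> vJ k; apply/vJ; exists (fun l => (l == k)%:R).
by rewrite (bigD1 k) ?inE //= eqxx mul1r big1 ?addr0 // => l /andP[_ /negPf->]; rewrite mul0r.
Qed.

(** Induction on the generators: the coefficients of the head [x] in elements of [B] form an ideal.
    Lifts to [B] of its generators, together with generators of the part of [B] inside [span s],
    generate [B]. *)
Lemma noetherian_sub N (B : N -> Prop) (s : seq N) : noetherian A -> submodule B ->
  (forall y, B y -> span s y) -> fin_gen_sub B.
Proof.
move=> noethA; elim: s B => [|x s IH] B subB Bs.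
  by exists [::]; split=> // y /Bs ->.
pose J : {pred A} := fun a => `[< exists2 y, B y & span s (y - a *: x) >].
have idJ : ideal J.
  split=> [|a b c]; first apply/asboolP.
    by exists 0; [case: subB | rewrite scale0r subr0; case: (span_submodule s)].
  move=> /asboolP[y By ys] /asboolP[z Bz zs]; apply/asboolP.
  exists (a *: y + z); first by case: subB => _; apply.
  have [_ /(_ a _ _ ys zs)] := span_submodule s; congr (span s _).
  by rewrite scalerBr scalerDl scalerA opprD addrACA.
have [n [v genJ]] := noethA J idJ.
have /choice[w wP] k : exists y, B y /\ span s (y - v k *: x).
  by have /asboolP[y By ys] := generated_mem genJ k; exists y.
have subs := span_submodule s.
have [||t [tB Bt]] := IH (fun y => B y /\ span s y).
- split=> [|a y z [By ys] [Bz zs]]; first by case: subB; case: subs.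
  by case: subB => _ BD; case: subs => _ sD; split; [apply: BD | apply: sD].
- by move=> y [].
exists (codom w ++ t); split=> [y|y By].
  by rewrite mem_cat => /orP[/codomP[k ->]|/tB[]//]; case: (wP k).
have [a ya] := Bs y By.
have /genJ[c aE] : a \in J by apply/asboolP; exists y.
have wc : span (codom w ++ t) (\sum_k c k *: w k).
  apply: submodule_sum (span_submodule _) _ => k _.
  by apply: span_mem; rewrite mem_cat codom_f.
rewrite -(subrK (\sum_k c k *: w k) y) -[X in span _ (X + _)]scale1r.
have [_ spD] := span_submodule (codom w ++ t); apply: spD => //.
apply: (@span_sub _ t) => [z zt|]; first by rewrite mem_cat zt orbT.
apply: Bt; split.
  by apply: submoduleB => //; apply: submodule_sum => // k _; case: (wP k).
have -> : y - \sum_k c k *: w k = (y - a *: x) - \sum_k c k *: (w k - v k *: x).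
  rewrite [X in _ = _ - X](eq_bigr (fun k => c k *: w k - (c k * v k) *: x)); last first.
    by move=> k _; rewrite scalerBr scalerA.
  rewrite sumrB -scaler_suml aE (eq_bigl _ _ (fun k => in_setT k)).
  by rewrite opprB addrA subrK.
by apply: submoduleB => //; apply: submodule_sum => // k _; case: (wP k).
Qed.

Lemma fin_gen_ffun N n : fin_gen_module N -> fin_gen_module {ffun 'I_n -> N}.
Proof.
move=> /fin_gen_moduleP[s sN]; apply/fin_gen_moduleP.
pose dl (k : 'I_n) (x : N) : {ffun 'I_n -> N} := [ffun l => if l == k then x else 0].
exists [seq dl k x | k <- enum 'I_n, x <- s] => y.
have -> : y = \sum_k 1 *: dl k (y k).
  apply/ffunP=> l; rewrite sum_ffunE (bigD1 l) //= !ffunE scale1r eqxx.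
  by rewrite big1 ?addr0 // => k kl; rewrite !ffunE eq_sym (negPf kl) scaler0.
apply: submodule_sum (span_submodule _) _ => k _.
apply: (span_min (s := s) (B := fun x => span _ (dl k x))) => //; last first.
  by move=> x xs; apply: span_mem; apply/allpairsP; exists (k, x); rewrite mem_enum.
have [sp0 spD] := span_submodule [seq dl k x | k <- enum 'I_n, x <- s].
split=> [|a x z xs zs].
  by have -> : dl k 0 = 0 by apply/ffunP=> l; rewrite !ffunE if_same.
have -> : dl k (a *: x + z) = a *: dl k x + dl k z; last exact: spD.
by apply/ffunP=> l; rewrite !ffunE; case: ifP => _ //; rewrite scaler0 addr0.
Qed.
End Span.

Section Noetherian.
Variable A : comNzRingType.
Hypothesis noethA : noetherian A.

Lemma ideal_sum (J : {pred A}) (T : finType) (Q : pred T) (c v : T -> A) :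
  ideal J -> (forall k, v k \in J) -> \sum_(k | Q k) c k * v k \in J.
Proof.
move=> [J0 JD] vJ; apply: (big_rec (fun x => x \in J)) => // k x _ xJ.
exact: (JD (c k)).
Qed.

(** A counterexample would yield, by dependent choice, a strictly ascending chain of ideals; the
    finitely many generators of the union already lie in one member. *)
Lemma noetherian_ind (P : {pred A} -> Prop) :
  (forall J, ideal J -> (forall J' : {pred A}, ideal J' -> {subset J <= J'} ->
     (exists2 a, a \in J' & a \notin J) -> P J') -> P J) ->
  forall J, ideal J -> P J.
Proof.
move=> IH J0 idJ0; apply: contrapT => nPJ0.
pose bad J := ideal J /\ ~ P J.
have step (J : {J | bad J}) : {J' : {J' | bad J'} | {subset sval J <= sval J'} /\
    exists2 a, a \in sval J' & a \notin sval J}.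
  apply: cid; case: J => J [idJ nPJ] /=; apply: contrapT => H.
  apply: nPJ; apply: IH => // J' idJ' sJJ' aJ'; apply: contrapT => nPJ'.
  by apply: H; exists (exist bad J' (conj idJ' nPJ')).
pose G := fix G n := if n is n'.+1 then sval (step (G n'))
                     else exist bad J0 (conj idJ0 nPJ0).
have GS n : {subset sval (G n) <= sval (G n.+1)} by case: (svalP (step (G n))).
have Gle n n' : (n <= n')%N -> {subset sval (G n) <= sval (G n')}.
  elim: n' => [|n' IHn]; first by rewrite leqn0 => /eqP->.
  by rewrite leq_eqVlt => /predU1P[->//|/IHn s] a /s /GS.
have idG n : ideal (sval (G n)) by case: (svalP (G n)).
pose U : {pred A} := fun a => `[< exists n, a \in sval (G n) >].
have idU : ideal U.
  split=> [|a b c]; first by apply/asboolP; exists 0%N; case: (idG 0%N).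
  move=> /asboolP[n bn] /asboolP[n' cn]; apply/asboolP; exists (maxn n n').
  have [_ GD] := idG (maxn n n'); apply: GD.
    by apply: Gle bn; apply: leq_maxl.
  by apply: Gle cn; apply: leq_maxr.
have [m [u genU]] := noethA idU.
have /choice[N uN] k : exists n, u k \in sval (G n).
  by have /asboolP := generated_mem genU k.
pose n := (\max_k N k)%N.
have [_ [a aS]] := svalP (step (G n)); case/negP.
have /genU[c ->] : a \in U by apply/asboolP; exists n.+1.
by apply: ideal_sum => // k; apply: Gle (uN k); apply: leq_bigmax.
Qed.

Lemma mx_factor p q r t (E : 'M[A]_(q, r)) (D : 'M[A]_(p, q)) (X : 'M_(q, t)) :
  mx_exact E D A^o -> D *m X = 0 -> exists Z, X = E *m Z.
Proof.
move=> ex DX0; have /choice[z zE] j :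
    exists z : {ffun 'I_r -> A^o}, [ffun i => X i j : A^o] = act E z.
  apply: ex; apply/ffunP=> i; move/matrixP: DX0 => /(_ i j).
  rewrite !mxE !ffunE => DX; rewrite -[RHS]DX.
  by apply: eq_bigr => k _; rewrite ffunE.
exists (\matrix_(i, j) z j i); apply/matrixP=> i j.
move/ffunP: (zE j) => /(_ i); rewrite !ffunE mxE => ->.
by apply: eq_bigr => k _; rewrite mxE.
Qed.

Lemma fin_gen_regular : fin_gen_module A^o.
Proof.
exists 1%N, (fun=> 1) => y; exists (fun=> y).
by rewrite big_ord1 -[LHS]mulr1.
Qed.

Lemma kernel_matrix p q (D : 'M[A]_(p, q)) :
  exists r (E : 'M[A]_(q, r)), D *m E = 0 /\ mx_exact E D A^o.
Proof.
have /fin_gen_moduleP[s sp] := fin_gen_ffun q fin_gen_regular.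
have [||t [tB Bt]] := @noetherian_sub A _ (fun y => act D y = 0) s noethA.
- split=> [|a x y Dx Dy]; first exact: linear0.
  by rewrite linearP /= Dx Dy scaler0 addr0.
- by move=> y _; apply: sp.
exists (size t), (\matrix_(i, k) t`_k i); split.
  apply/matrixP=> i k; have /tB/ffunP/(_ i) : t`_k \in t by apply: mem_nth.
  rewrite !ffunE !mxE => tk; rewrite -[RHS]tk.
  by apply: eq_bigr => j _; rewrite mxE.
move=> y /Bt/span_nth[c ->]; exists [ffun k => c k]; apply/ffunP=> i.
rewrite sum_ffunE ffunE; apply: eq_bigr => k _.
by rewrite !ffunE mxE; apply: mulrC.
Qed.

(** The clause on [P] is a Leibniz equality between [D0] and [D 0]: their sizes are only
    propositionally equal, and this form avoids a cast. *)
Lemma free_resolution a b (D0 : 'M[A]_(a, b)) :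
  exists (n : nat -> nat) (D : forall j, 'M[A]_(n j, n j.+1)),
    (forall P : forall p q, 'M[A]_(p, q) -> Prop, P _ _ D0 -> P _ _ (D 0)) /\
    forall j, D j *m D j.+1 = 0 /\ mx_exact (D j.+1) (D j) A^o.
Proof.
have K (t : {p : nat & {q : nat & 'M[A]_(p, q)}}) :
    {E : {r : nat & 'M[A]_(projT1 (projT2 t), r)} |
      projT2 (projT2 t) *m projT2 E = 0 /\
      mx_exact (projT2 E) (projT2 (projT2 t)) A^o}.
  apply: cid; case: t => p [q D] /=; have [r [E H]] := kernel_matrix D.
  by exists (existT _ r E).
pose G := fix G j : {p : nat & {q : nat & 'M[A]_(p, q)}} :=
  if j is i.+1 then existT _ (projT1 (projT2 (G i))) (sval (K (G i)))
  else existT _ a (existT _ b D0).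
exists (fun j => projT1 (G j)), (fun j => projT2 (projT2 (G j))).
by split=> // j; apply: (svalP (K (G j))).
Qed.

(** The hypothesis on [S0] says that [u] annihilates the cokernel of [D 0]. The homotopy is built
    degree by degree; the invariant [good] is what lets [u%:M - S *m D j] factor through
    [D j.+1]. *)
Lemma homotopies (n : nat -> nat) (D : forall j, 'M[A]_(n j, n j.+1)) (u : A) :
  (forall j, D j *m D j.+1 = 0 /\ mx_exact (D j.+1) (D j) A^o) ->
  (exists S0, D 0 *m S0 = u%:M) ->
  exists S : forall j, 'M[A]_(n j.+1, n j),
    D 0 *m S 0 = u%:M /\ forall j, D j.+1 *m S j.+1 + S j *m D j = u%:M.
Proof.
move=> DP [S0 S0E].
pose good j (S : 'M_(n j.+1, n j)) := D j *m (u%:M - S *m D j) = 0.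
have step j (S : {S | good j S}) : {S' : {S' | good j.+1 S'} |
    D j.+1 *m sval S' + sval S *m D j = u%:M}.
  apply: cid; case: S => S gS /=; have [DD ex] := DP j.
  have [S' S'E] := mx_factor ex gS.
  have gS' : good j.+1 S'.
    by rewrite /good mulmxBr scalar_mxC mulmxA -S'E mulmxBl -mulmxA DD mulmx0 subr0 subrr.
  by exists (exist _ S' gS'); rewrite /= -S'E subrK.
have g0 : good 0%N S0.
  by rewrite /good mulmxBr scalar_mxC mulmxA S0E subrr.
pose G := fix G j : {S | good j S} := match j return {S | good j S} with
  | 0 => exist _ S0 g0 | i.+1 => sval (step i (G i)) end.
by exists (fun j => sval (G j)); split=> // j; apply: (svalP (step j (G j))).
Qed.
End Noetherian.

Section Local.
Variables (A : comNzRingType) (mm : {pred A}).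
Hypotheses (noethA : noetherian A) (localA : local_ring mm).

Lemma idealr_closedP (J : {pred A}) : idealr_closed J <-> ideal J /\ 1 \notin J.
Proof. by split=> [[J0 J1 JD]|[[J0 JD] J1]]; split. Qed.

Lemma mm_ideal : ideal mm.
Proof. by case: localA => -[/idealr_closedP[]]. Qed.

(** Noetherian induction takes the place of Zorn's lemma: a proper ideal is maximal, hence equal to
    [mm], or lies in a larger proper ideal. *)
Lemma proper_sub_mm (J : {pred A}) : ideal J -> 1 \notin J -> {subset J <= mm}.
Proof.
move: J; apply: (noetherian_ind noethA (P := fun J => 1 \notin J -> {subset J <= mm})).
move=> J idJ IH J1.
have [maxJ|nmaxJ] := lem (maximal_ideal J).
  by move=> x; rewrite (localA.2 _ maxJ).
apply: contrapT => nJ; apply: nmaxJ; split; first exact/idealr_closedP.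
move=> J' /idealr_closedP[idJ' J'1] JJ' x; apply/idP/idP; first exact: JJ'.
move=> xJ'; apply/negPn/negP => xJ; apply: nJ => y /JJ'.
by apply: IH => //; exists x.
Qed.

Lemma unit_notin_mm a : a \notin mm -> exists b, b * a = 1.
Proof.
move=> am; pose J : {pred A} := fun x => `[< exists b, b * a = x >].
have idJ : ideal J.
  split=> [|c x y /asboolP[b bx] /asboolP[b' by']]; apply/asboolP.
    by exists 0; rewrite mul0r.
  by exists (c * b + b'); rewrite mulrDl -mulrA bx by'.
have aJ : a \in J by apply/asboolP; exists 1; rewrite mul1r.
have [/asboolP //|J1] := boolP (1 \in J).
by rewrite (proper_sub_mm idJ J1 aJ) in am.
Qed.

Lemma unit_1subr a : a \in mm -> exists b, b * (1 - a) = 1.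
Proof.
move=> am; apply: unit_notin_mm; apply/negP => m1.
have /idealr_closedP[[_ mD]] : idealr_closed mm by case: localA => -[].
by case/negP; have := mD 1 _ _ am m1; rewrite scale1r addrC subrK.
Qed.

(** Generators are discarded one at a time: expanding [x] as an element of mm N and reducing modulo
    the remaining generators gives (1 - e) x = 0 for some e in mm, and 1 - e is invertible. *)
Lemma nakayama (N : lmodType A) : fin_gen_module N ->
  (forall y : N, exists n (a : 'I_n -> A) (z : 'I_n -> N),
     (forall i, a i \in mm) /\ y = \sum_i a i *: z i) ->
  forall y : N, y = 0.
Proof.
move=> /fin_gen_moduleP[s]; elim: s => [|x s IH] // sp Nm; apply: IH => // y.
have subs := span_submodule s.
suff xs : span s x.
  apply: (span_min (s := x :: s)) => // z.
  by rewrite inE => /predU1P[->|/span_mem].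
have [n [a [z [am xE]]]] := Nm x.
have /choice[b zb] i : exists b, span s (z i - b *: x) by apply: (sp (z i)).
have [|e eE] := @unit_1subr (\sum_i b i * a i); first exact: ideal_sum mm_ideal am.
rewrite -[x]scale1r -eE -scalerA scalerBl scale1r {1}xE scaler_suml -sumrB.
apply: submoduleZ => //.
rewrite (eq_bigr (fun i => a i *: (z i - b i *: x))) => [|i _].
  by apply: submodule_sum.
by rewrite scalerBr scalerA mulrC.
Qed.

Lemma minimal_generators (N : lmodType A) : fin_gen_module N ->
  exists n (x : 'I_n -> N), (forall y, exists c, y = \sum_k c k *: x k) /\
    forall c, \sum_k c k *: x k = 0 -> forall k, c k \in mm.
Proof.
move=> [n0 [x0 gen0]].
pose gen n := `[< exists x : 'I_n -> N, forall y, span (codom x) y >].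
have [|n /asboolP[x genx] minn] := @ex_minnP gen.
  by exists n0; apply/asboolP; exists x0 => y; apply/span_codom; apply: gen0.
exists n, x; split=> [y|c c0 k]; first exact/span_codom.
apply/negPn/negP => /unit_notin_mm[b bc].
case: n x k c bc c0 genx minn => [|n] x k c bc c0 genx minn; first by case: (k).
suff /minn : gen n by rewrite ltnn.
apply/asboolP; exists (x \o lift k) => y.
apply: (span_min (s := codom x) (span_submodule _)) => // _ /codomP[i ->].
case: (unliftP k i) => [j ->|->]; first exact/span_mem/(codom_f (x \o lift k)).
have -> : x k = \sum_j (- (b * c (lift k j))) *: (x \o lift k) j.
  move/eqP: c0; rewrite (bigD1_ord k) //= addr_eq0 => /eqP ck.
  rewrite -[x k]scale1r -bc -scalerA ck scalerN scaler_sumr -sumrN.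
  by apply: eq_bigr => j _; rewrite scalerA scaleNr.
by apply/span_codom; eexists.
Qed.
End Local.

(** * Projective and injective modules *)

Section FreeModule.
Variables (A : comNzRingType) (P : lmodType A).

Definition finsupp_pred : {pred P -> A^o} :=
  fun f => `[< exists s : seq P, forall x, x \notin s -> f x = 0 >].

Fact finsupp_submod_closed : submod_closed finsupp_pred.
Proof.
split=> [|a f g /asboolP[s sf] /asboolP[t tg]]; apply/asboolP.
  by exists [::].
exists (s ++ t) => x; rewrite mem_cat negb_or => /andP[/sf fx /tg gx].
by rewrite -[LHS]/(a *: f x + g x) fx gx scaler0 addr0.
Qed.
HB.instance Definition _ :=
  GRing.isSubmodClosed.Build A (P -> A^o) finsupp_pred finsupp_submod_closed.

Definition free_module := {f : P -> A^o | finsupp_pred f}.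
HB.instance Definition _ := SubChoice.on free_module.
HB.instance Definition _ := [SubChoice_isSubLmodule of free_module by <:].

Fact free_support (f : free_module) :
  exists s : seq P, uniq s /\ forall x, x \notin s -> val f x = 0.
Proof.
have /asboolP[s sf] := valP f; exists (undup s); split; first exact: undup_uniq.
by move=> x; rewrite mem_undup; apply: sf.
Qed.

Definition free_eval (f : free_module) : P :=
  \sum_(x <- sval (cid (free_support f))) val f x *: x.

Lemma free_evalE (f : free_module) (t : seq P) : uniq t ->
  (forall x, x \notin t -> val f x = 0) -> free_eval f = \sum_(x <- t) val f x *: x.
Proof.
rewrite /free_eval; case: cid => s /= [us sf] ut tf.
have E (r : seq P) : \sum_(x <- r) val f x *: x =
    \sum_(x <- [seq x <- r | val f x != 0]) val f x *: x.
  rewrite big_filter [RHS]big_mkcond; apply: eq_bigr => x _ /=.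
  by case: eqVneq => [->|//]; rewrite scale0r.
rewrite E [RHS]E; apply: perm_big; apply: uniq_perm; rewrite ?filter_uniq //.
move=> x; rewrite !mem_filter; case: eqVneq => //= fx.
have [xs|/sf fx0] := boolP (x \in s); last by rewrite fx0 eqxx in fx.
by apply/esym/negPn/negP => /tf fx0; rewrite fx0 eqxx in fx.
Qed.

Lemma free_eval_seq (I : finType) (f : I -> free_module) :
  exists t : seq P, forall i, free_eval (f i) = \sum_(x <- t) val (f i) x *: x.
Proof.
have /choice[s sP] i := free_support (f i).
exists (undup (flatten [seq s i | i <- enum I])) => i.
apply: free_evalE => [|x]; first exact: undup_uniq.
rewrite mem_undup => /negP xs; apply: (sP i).2; apply/negP => xi; apply: xs.
by apply/flatten_mapP; exists i; rewrite ?mem_enum.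
Qed.

Fact free_eval_is_linear : linear free_eval.
Proof.
move=> a f g.
(* The three evaluations use independently chosen supports; a common one reduces linearity to a
   termwise identity. *)
have [t tP] := free_eval_seq (fun i : 'I_3 => nth 0 [:: f; g; a *: f + g] i).
move: (tP (inord 0)) (tP (inord 1)) (tP (inord 2)); rewrite !inordK //= => -> -> ->.
rewrite scaler_sumr -big_split /=.
by apply: eq_bigr => x _; rewrite scalerA -scalerDl.
Qed.
HB.instance Definition _ :=
  GRing.isLinear.Build A free_module P *:%R free_eval free_eval_is_linear.

Lemma free_eval_surjective : surjective free_eval.
Proof.
move=> y; have dy : finsupp_pred (fun x => (x == y)%:R : A^o).
  by apply/asboolP; exists [:: y] => x; rewrite inE => /negPf->.
exists (Sub _ dy); rewrite [LHS](@free_evalE _ [:: y]) // => [|x].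
  by rewrite big_seq1 SubK eqxx scale1r.
by rewrite SubK inE => /negPf->.
Qed.

(** [P] is a direct summand of a free module, where the system can be solved in each coordinate [x]
    over [A]; only the finitely many coordinates in [t] contribute. *)
Lemma projective_mx_exact p q r (E : 'M[A]_(q, r)) (D : 'M[A]_(p, q)) :
  projective P -> mx_exact E D A^o -> mx_exact E D P.
Proof.
move=> projP ex y Dy.
have [h hK] := projP _ _ free_eval (idfun : {linear P -> P}) free_eval_surjective.
have [t tP] := free_eval_seq (fun b => h (y b)).
pose c x : {ffun 'I_q -> A^o} := [ffun b => val (h (y b)) x].
have /choice[z zE] x : exists z, c x = act E z.
  apply: ex; apply/ffunP=> a; move/ffunP: Dy => /(_ a); rewrite !ffunE => Dy.
  transitivity (val (h (\sum_b D a b *: y b)) x); last by rewrite Dy !linear0.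
  rewrite !linear_sum fct_sumE; apply: eq_bigr => b _.
  by rewrite ffunE !linearZ.
exists [ffun k => \sum_(x <- t) z x k *: x]; apply/ffunP=> b.
rewrite ffunE; have /= -> := etrans (esym (hK (y b))) (tP b).
transitivity (\sum_(x <- t) \sum_k (E b k * z x k) *: x).
  apply: eq_bigr => x _; rewrite -scaler_suml; congr (_ *: _).
  by move/ffunP: (zE x) => /(_ b); rewrite !ffunE.
rewrite exchange_big /=; apply: eq_bigr => k _.
by rewrite ffunE scaler_sumr; apply: eq_bigr => x _; rewrite scalerA.
Qed.
End FreeModule.

(** * Extension of partial homomorphisms and Baer's criterion *)

Section Extension.
Variable A : comNzRingType.
Implicit Types W E : lmodType A.

(** The graph of a homomorphism defined on a submodule of [W]; graphs are sets of pairs, so Zorn's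
    lemma applies to them by inclusion. *)
Definition partial_hom W E (G : W -> E -> Prop) : Prop :=
  [/\ G 0 0, forall a x e x' e', G x e -> G x' e' -> G (a *: x + x') (a *: e + e')
    & forall e, G 0 e -> e = 0].

Definition extension_property E : Prop :=
  forall W (G : W -> E -> Prop), partial_hom G ->
    exists h : {linear W -> E}, forall x e, G x e -> h x = e.

(** A homomorphism J -> E, given as a function on all of [A] with arbitrary values outside [J]. *)
Definition hom_on (J : {pred A}) E (phi : A -> E) : Prop :=
  forall a b c, b \in J -> c \in J -> phi (a * b + c) = a *: phi b + phi c.

(** For an ideal [J] this is Ext^1(A/J, E) = 0, as homomorphisms A -> E are the maps b |-> b z. *)
Definition hom_extends (J : {pred A}) E : Prop :=
  forall phi : A -> E, hom_on J phi -> exists z, forall b, b \in J -> phi b = b *: z.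

Lemma hom_on0 (J : {pred A}) E (phi : A -> E) :
  ideal J -> hom_on J phi -> phi 0 = 0.
Proof.
move=> [J0 _] /(_ (-1) 0 0 J0 J0).
by rewrite mulr0 addr0 scaleN1r addNr.
Qed.

Lemma partial_hom_fun W E (G : W -> E -> Prop) x e e' :
  partial_hom G -> G x e -> G x e' -> e = e'.
Proof.
case=> _ GD G0 xe xe'; have := GD (-1) _ _ _ _ xe' xe.
by rewrite !scaleN1r addNr addrC => /G0/eqP; rewrite subr_eq0 => /eqP.
Qed.

Lemma partial_hom_total W E (G : W -> E -> Prop) : partial_hom G ->
  (forall x, exists e, G x e) ->
  exists h : {linear W -> E}, forall x e, G x e -> h x = e.
Proof.
move=> pG /choice[h hP].
have hlin : linear h.
  move=> a x y; apply: (partial_hom_fun pG (hP _)).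
  by case: pG => _ GD _; apply: GD.
pose hL := GRing.isLinear.Build A W E *:%R h hlin.
pose hh : {linear W -> E} := HB.pack h hL.
by exists hh => x e xe; apply: (partial_hom_fun pG (hP x)).
Qed.

Lemma injective_extension E : injective_module E <-> extension_property E.
Proof.
split=> [injE W G pG | extE V W g f gI].
  case: (pG) => G0 GD GI.
  pose B : {pred W} := fun x => `[< exists e, G x e >].
  have subB : submod_closed B.
    split=> [|a x y /asboolP[e xe] /asboolP[e' ye']]; apply/asboolP.
      by exists 0.
    by exists (a *: e + e'); apply: GD.
  (* The domain of [G] becomes a module as the kernel of W -> W/B. *)
  pose V : lmodType A := ker_module (quot_pi subB).
  pose G' (v : V) := G (val v).
  have [||h hG] := @partial_hom_total V E G'.
  - split=> [|a x e x' e'|e]; rewrite /G' ?linear0 //; last exact: GI.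
    by rewrite linearP; apply: GD.
  - move=> v; have /eqP/quot_pi_eq0/asboolP[e ve] : ker_pred (quot_pi subB) (val v).
      exact: (valP v).
    by exists e.
  have [k kE] := injE V W val h val_inj; exists k => x e xe.
  have kx : ker_pred (quot_pi subB) x.
    by apply/eqP/quot_pi_eq0/asboolP; exists e.
  have -> : x = val (Sub x kx : V) by rewrite SubK.
  by rewrite kE; apply: hG; rewrite /G' SubK.
pose G w e := exists v, w = g v /\ e = f v.
have [|h hG] := extE W G; last by exists h => x; apply: hG; exists x.
split=> [|a _ _ _ _ [v [-> ->]] [v' [-> ->]]|e [v [gv ->]]].
- by exists 0; rewrite !linear0.
- by exists (a *: v + v'); rewrite !linearP.
- by have -> : v = 0; [apply: gI; rewrite -gv linear0 | rewrite linear0].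
Qed.

Lemma injective_hom_extends E (J : {pred A}) :
  injective_module E -> ideal J -> hom_extends J E.
Proof.
move=> /injective_extension extE [J0 JD] phi phiD.
pose G (x : A^o) e := x \in J /\ e = phi x.
have phi0 : phi 0 = 0 by apply: hom_on0 phiD.
have [|h hG] := extE A^o G.
  split=> [|a x e x' e' [xJ ->] [x'J ->]|e [_ ->]] //.
  by split; [apply: JD | rewrite -phiD].
exists (h 1) => b bJ; rewrite -linearZ /=; apply/esym/hG.
by rewrite /G -[_ *: _]/(b * 1) mulr1.
Qed.

(* Baer's criterion: a maximal extension of G is total, for it could
   otherwise be extended to one more element w through the ideal of all a
   such that a *: w lies in its domain. *)
Lemma baer_extension E :
  (forall J, ideal J -> hom_extends J E) -> extension_property E.
Proof.
move=> baerE W G pG.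
(* The condition holds vacuously for the empty set, the union of the empty chain; a maximal [S] is
   nonempty because otherwise the graph of [G] would be larger. *)
pose adm (S : classical_sets.set (W * E)) := forall p, S p ->
  partial_hom (fun x e => S (x, e)) /\ forall x e, G x e -> S (x, e).
have [F Fadm Ftot|S [Sadm Smax]] := @classical_sets.Zorn_bigcup (W * E)%type adm.
  move=> p [X FX Xp]; have [pX GX] := Fadm X FX p Xp.
  split=> [|x e /GX Xxe]; last by exists X.
  split=> [|a x e x' e' [Y FY Yx] [Z FZ Zx]|e [Y FY Y0]].
  - by exists X => //; case: pX.
  - have [YZ|ZY] := Ftot Y Z FY FZ.
      by exists Z => //; have [[_ ZD _] _] := Fadm Z FZ _ Zx; apply: ZD => //; apply: YZ.
    by exists Y => //; have [[_ YD _] _] := Fadm Y FY _ Yx; apply: YD => //; apply: ZY.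
  - by have [[_ _ Yf] _] := Fadm Y FY _ Y0; apply: Yf.
have S0 : S (0, 0).
  apply: contrapT => nS; apply: (Smax (fun p => G p.1 p.2)).
    split=> [p /Sadm[[S0 _ _] _] //|sub].
    by apply/nS/sub; case: pG.
  by move=> p _; split.
have [pS GS] := Sadm _ S0; case: (pS) => _ SD SI.
have [|h hS] := @partial_hom_total W E (fun x e => S (x, e)) pS; last first.
  by exists h => x e /GS; apply: hS.
move=> w; apply: contrapT => nw.
pose J : {pred A} := fun a => `[< exists e, S (a *: w, e) >].
have idJ : ideal J.
  split=> [|a b c /asboolP[e be] /asboolP[e' ce']]; apply/asboolP.
    by exists 0; rewrite scale0r.
  by exists (a *: e + e'); rewrite scalerDl -scalerA; apply: SD.
have /choice[phi phiP] a : exists e, a \in J -> S (a *: w, e).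
  by have [/asboolP[e ae]|_] := boolP (a \in J); [exists e | exists 0].
have [a b c bJ cJ|z zP] := baerE J idJ phi.
  apply: (partial_hom_fun pS (phiP _ _)); first by case: idJ => _; apply.
  by rewrite scalerDl -scalerA; apply: SD; apply: phiP.
pose S' p := exists x e a, [/\ S (x, e), p.1 = x + a *: w & p.2 = e + a *: z].
have SS' p : S p -> S' p.
  by case: p => x e xe; exists x, e, 0; rewrite !scale0r !addr0.
apply: (Smax S').
  split=> // sub; apply: nw; exists z; apply: sub.
  by exists 0, 0, 1; rewrite !scale1r !add0r.
move=> _ _; split=> [|x e /GS/SS' //]; split; first exact: SS'.
  move=> a _ _ _ _ [x [e [b [xe /= -> ->]]]] [x' [e' [b' [xe' /= -> ->]]]].
  exists (a *: x + x'), (a *: e + e'), (a * b + b').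
  split; first exact: SD.
    by rewrite /= scalerDr scalerDl scalerA addrACA.
  by rewrite /= scalerDr scalerDl scalerA addrACA.
move=> _ [x [e [a [xe /= xw ->]]]].
have Sa : S (a *: w, - e).
  have := SD (-1) _ _ _ _ xe S0; rewrite !scaleN1r !addr0.
  by move/eqP: xw; rewrite eq_sym addrC addr_eq0 => /eqP->.
have aJ : a \in J by apply/asboolP; exists (- e).
by rewrite -(zP a aJ) (partial_hom_fun pS (phiP a aJ) Sa) subrr.
Qed.
End Extension.

Section InjectiveExact.
Variable A : comNzRingType.

Lemma pairing_eq0 (N : lmodType A) p q r (E : 'M[A]_(q, r)) (D : 'M[A]_(p, q))
    (c : {ffun 'I_q -> A^o}) (y : {ffun 'I_q -> N}) :
  mx_exact E D A^o -> act D c = 0 -> act E^T y = 0 -> \sum_b c b *: y b = 0.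
Proof.
move=> ex /ex[z ->] Ey; transitivity (\sum_k z k *: act E^T y k); last first.
  by rewrite Ey big1 // => k _; rewrite ffunE scaler0.
rewrite (eq_bigr (fun b => \sum_k z k *: (E b k *: y b))) => [|b _].
  rewrite exchange_big; apply: eq_bigr => k _ /=.
  by rewrite ffunE scaler_sumr; apply: eq_bigr => b _; rewrite mxE.
rewrite ffunE scaler_suml; apply: eq_bigr => k _.
by rewrite scalerA [z k * _]mulrC.
Qed.

(** Exactness of Hom(-, N): pairing with [y] kills the kernel of [D], so it factors through the
    image of [D], and the factor extends to A^p. Its values on the standard basis form the preimage
    of [y]. *)
Lemma injective_mx_exact (N : lmodType A) p q r (E : 'M[A]_(q, r)) (D : 'M[A]_(p, q)) :
  injective_module N -> mx_exact E D A^o -> mx_exact D^T E^T N.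
Proof.
move=> /injective_extension extN ex y Ey.
pose ev (c : {ffun 'I_q -> A^o}) : N := \sum_b c b *: y b.
have evP a c c' : ev (a *: c + c') = a *: ev c + ev c'.
  rewrite /ev scaler_sumr -big_split; apply: eq_bigr => b _ /=.
  by rewrite !ffunE scalerDl scalerA.
pose G (v : {ffun 'I_p -> A^o}) e := exists c, act D c = v /\ ev c = e.
have [|h hG] := extN _ G.
  split=> [|a _ _ _ _ [c [<- <-]] [c' [<- <-]]|_ [c [Dc <-]]].
  - by exists 0; rewrite linear0 /ev big1 // => b _; rewrite ffunE scale0r.
  - by exists (a *: c + c'); rewrite linearP evP.
  exact: pairing_eq0 ex Dc Ey.
pose dl n (k : 'I_n) : {ffun 'I_n -> A^o} := [ffun l => (l == k)%:R].
exists [ffun i => h (dl p i)]; apply/ffunP=> b.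
have <- : ev (dl q b) = y b.
  rewrite /ev (bigD1 b) //= ffunE eqxx scale1r big1 ?addr0 // => k kb.
  by rewrite ffunE (negPf kb) scale0r.
rewrite -(hG (act D (dl q b)) (ev (dl q b))); last by exists (dl q b).
transitivity (h (\sum_i D i b *: dl p i)); last first.
  rewrite linear_sum ffunE; apply: eq_bigr => i _.
  by rewrite mxE ffunE linearZ.
congr (h _); apply/ffunP=> i.
rewrite sum_ffunE ffunE (bigD1 b) //= (bigD1 i) //= !ffunE !eqxx.
rewrite !big1 ?addr0 // => [k kb|k kb]; rewrite !ffunE.
  by rewrite eq_sym (negPf kb) scaler0.
by rewrite (negPf kb) scaler0.
Qed.
End InjectiveExact.

(** * Divisible abelian groups and the group Q/Z *)

Section Divisible.

Lemma int_ideal_principal (J : {pred int}) : ideal J ->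
  exists p : nat, forall b, b \in J <-> exists c : int, b = c * p%:Z.
Proof.
move=> [J0 JD].
have JM a b : b \in J -> a * b \in J.
  by move=> bJ; have := JD a b 0 bJ J0; rewrite addr0.
have [[a aJ a0]|nJ] := lem (exists2 a, a \in J & a != 0); last first.
  exists 0%N => b; split=> [bJ|[c ->]]; last by rewrite mulr0.
  exists 0; rewrite mulr0; apply/eqP/negPn/negP => b0.
  by apply: nJ; exists b.
pose Q n := (0 < n)%N && (n%:Z \in J).
have [|p /andP[p0 pJ] pmin] := @ex_minnP Q.
  exists `|a|%N; rewrite /Q absz_gt0 a0 /= abszEsg.
  exact: JM.
exists p => b; split=> [bJ|[c ->]]; last exact: JM.
exists (b %/ p)%Z; rewrite {1}(divz_eq b p).
suff -> : (b %% p)%Z = 0 by rewrite addr0.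
have rJ : (b %% p)%Z \in J.
  have := JD (- (b %/ p)%Z) _ _ pJ bJ.
  by rewrite {2}(divz_eq b p) scaleNr -[_ *: _]/(_ * _) addKr.
have r0 : (0 <= (b %% p)%Z)%R by apply: modz_ge0; rewrite eqz_nat -lt0n.
have rp : ((b %% p)%Z < p%:Z)%R by apply: ltz_pmod.
case: (b %% p)%Z rJ r0 rp => // -[//|n] nJ _ np.
by have := pmin n.+1 nJ; rewrite leqNgt -ltz_nat np.
Qed.

Definition divisible (G : lmodType int) : Prop :=
  forall (n : int) (y : G), n != 0 -> exists z, n *: z = y.

Lemma divisible_injective (G : lmodType int) : divisible G -> extension_property G.
Proof.
move=> divG; apply: baer_extension => J idJ phi phiD.
have [p pP] := int_ideal_principal idJ.
have J0 : 0 \in J by case: idJ.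
have pJ : p%:Z \in J by apply/pP; exists 1; rewrite mul1r.
have phi0 : phi 0 = 0 := hom_on0 idJ phiD.
have phiM c : phi (c * p%:Z) = c *: phi p%:Z.
  by have := phiD c p%:Z 0 pJ J0; rewrite phi0 !addr0.
have [p0|p0] := eqVneq p 0%N.
  by exists 0 => b /pP[c ->]; rewrite p0 mulr0 phi0 scaler0.
have [|z zE] := divG p%:Z (phi p%:Z); first by rewrite eqz_nat.
by exists z => b /pP[c ->]; rewrite phiM -zE scalerA.
Qed.

Definition ratz : lmodType int := zmodule rat.

Definition intr_pred : {pred ratz} := fun x => `[< exists n : int, x = n%:~R >].

Fact intr_submod_closed : submod_closed intr_pred.
Proof.
split=> [|a x y /asboolP[n xn] /asboolP[k yk]]; apply/asboolP; first by exists 0.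
by exists (a * n + k); rewrite xn yk rmorphD rmorphM /= scalezrE mulrzl.
Qed.

Definition rat_mod_int : lmodType int := quot_module intr_submod_closed.

Lemma rat_mod_int_divisible : divisible rat_mod_int.
Proof.
move=> n y n0; exists (quot_pi intr_submod_closed ((repr y : rat) / n%:~R)).
rewrite -[LHS]quot_piZ -[RHS](quot_piK y); congr quot_pi.
by rewrite scalezrE -mulrzl mulrCA mulfV ?mulr1 // intr_eq0.
Qed.

Lemma rat_mod_int_separates (M : lmodType int) (x : M) : x != 0 ->
  exists h : {linear M -> rat_mod_int}, h x != 0.
Proof.
move=> x0; pose J : {pred int} := fun n => n *: x == 0.
have [|p pP] := @int_ideal_principal J.
  split=> [|a b c /eqP bJ /eqP cJ]; first by rewrite unfold_in scale0r.
  by rewrite unfold_in scalerDl -scalerA bJ cJ scaler0 addr0.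
have p1 : p != 1%N.
  apply/eqP => p1; case/negP: x0; rewrite -[x]scale1r; apply/pP.
  by exists 1; rewrite p1.
(* If [x] has finite order p, it must go to a class killed by p, and 1/p is nonzero as p is not 1.
   If the order is infinite (p = 0), any nonzero class will do, here 1/2. *)
pose t : rat := (if p == 0%N then 2 else p)%:R^-1.
pose q := quot_pi intr_submod_closed t.
have t0 : (if p == 0%N then 2 else p) != 0%N by case: ifP => [|/negbT].
have tN : (if p == 0%N then 2 else p)%:R != 0 :> rat by rewrite Num.Theory.pnatr_eq0.
have q0 : q != 0.
  apply/eqP => /quot_pi_eq0/asboolP[n tn].
  have : n * (if p == 0%N then 2 else p)%:Z = 1.
    by apply: (@intr_inj rat); rewrite rmorphM /= -tn /t mulVf.
  move/(congr1 absz); rewrite abszM /= => /eqP; rewrite muln_eq1 => /andP[_].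
  by case: (p =P 0%N) => // _; rewrite (negPf p1).
have [|h hG] := @divisible_injective _ rat_mod_int_divisible M
    (fun w e => exists n : int, w = n *: x /\ e = n *: q).
  split=> [|a _ _ _ _ [n [-> ->]] [n' [-> ->]]|_ [n [nx ->]]].
  - by exists 0; rewrite !scale0r.
  - by exists (a * n + n'); rewrite !scalerDl !scalerA.
  have /pP[c ->] : n \in J by rewrite unfold_in -nx.
  have [->|p0] := eqVneq p 0%N; first by rewrite mulr0 scale0r.
  rewrite -[LHS]quot_piZ; apply/quot_pi_eq0/asboolP; exists c.
  rewrite scalezrE /t (negPf p0) -mulrzl rmorphM /= -mulrA mulfV ?mulr1 //.
  by rewrite Num.Theory.pnatr_eq0.
exists h; rewrite (hG x q) //; exists 1; by rewrite !scale1r.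
Qed.
End Divisible.

(** * Enough injectives *)

Section Coinduced.
Variables (A : comNzRingType) (G : zmodType).

Definition additive_pred : {pred A -> G} :=
  fun f => `[< forall a b, f (a + b) = f a + f b >].

Fact additive_zmod_closed : zmod_closed additive_pred.
Proof.
split=> [|f g /asboolP fD /asboolP gD]; apply/asboolP => a b.
  by rewrite -[LHS]/(0 : G) -[RHS]/((0 : G) + 0) addr0.
rewrite -[LHS]/(f (a + b) - g (a + b)) fD gD.
by rewrite -[RHS]/((f a - g a) + (f b - g b)) opprD addrACA.
Qed.
HB.instance Definition _ :=
  GRing.isZmodClosed.Build (A -> G) additive_pred additive_zmod_closed.

(* Hom_Z(A, G) *)
Definition coinduced := {f : A -> G | additive_pred f}.
HB.instance Definition _ := SubChoice.on coinduced.
HB.instance Definition _ := [SubChoice_isSubZmodule of coinduced by <:].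

Lemma coinducedD (f : coinduced) a b : val f (a + b) = val f a + val f b.
Proof. by have /asboolP := valP f. Qed.

Fact coinduced_scale_subproof a (f : coinduced) :
  additive_pred (fun b => val f (b * a)).
Proof. by apply/asboolP => b c; rewrite mulrDl coinducedD. Qed.

Definition coinduced_scale a f : coinduced := Sub _ (coinduced_scale_subproof a f).

Lemma coinduced_scaleE a f b : val (coinduced_scale a f) b = val f (b * a).
Proof. by rewrite SubK. Qed.

Lemma coinduced_eq (f g : coinduced) : (forall b, val f b = val g b) -> f = g.
Proof. by move=> fg; apply/val_inj/funext. Qed.

Lemma coinduced_addE (f g : coinduced) b : val (f + g) b = val f b + val g b.
Proof. by rewrite raddfD. Qed.

Definition coinduced_at b (f : coinduced) : G := val f b.

Fact coinduced_at_is_additive b : zmod_morphism (coinduced_at b).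
Proof. by move=> f g; rewrite /coinduced_at raddfB. Qed.
HB.instance Definition _ b :=
  GRing.isZmodMorphism.Build coinduced G (coinduced_at b) (coinduced_at_is_additive b).

Fact coinduced_scaleA a b f :
  coinduced_scale a (coinduced_scale b f) = coinduced_scale (a * b) f.
Proof. by apply: coinduced_eq => c; rewrite !coinduced_scaleE mulrA. Qed.

Fact coinduced_scale1 : left_id 1 coinduced_scale.
Proof. by move=> f; apply: coinduced_eq => c; rewrite coinduced_scaleE mulr1. Qed.

Fact coinduced_scaleDr : right_distributive coinduced_scale +%R.
Proof.
move=> a f g; apply: coinduced_eq => c.
by rewrite coinduced_addE !coinduced_scaleE coinduced_addE.
Qed.

Fact coinduced_scaleDl f : {morph coinduced_scale^~ f : a b / a + b}.
Proof.
move=> a b; apply: coinduced_eq => c.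
by rewrite coinduced_addE !coinduced_scaleE mulrDr coinducedD.
Qed.

HB.instance Definition _ := GRing.Zmodule_isLmodule.Build A coinduced
  coinduced_scaleA coinduced_scale1 coinduced_scaleDr coinduced_scaleDl.

(** Adjunction: a linear map f into Hom_Z(A, G) is determined by the additive map v |-> f(v)(1),
    which is extended over Z to [h]; then w goes to a |-> h(a w). *)
Lemma coinduced_injective :
  extension_property (zmodule G : lmodType int) -> injective_module coinduced.
Proof.
move=> extG V W g f gI.
pose Gr (w : zmodule W) (e : zmodule G) := exists v, w = g v /\ e = val (f v) 1.
have valMz (x : coinduced) (n : int) b : val (x *~ n) b = val x b *~ n.
  exact: (raddfMz (coinduced_at b)).
have val0 b : val (0 : coinduced) b = 0 by exact: (raddf0 (coinduced_at b)).
have [|h hG] := extG (zmodule W) Gr.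
  split=> [|a _ _ _ _ [v [-> ->]] [v' [-> ->]]|e [v [gv ->]]].
  - by exists 0; rewrite !linear0 val0.
  - have DMz (N : lmodType A) (l : {linear V -> N}) :
        l (v *~ a + v') = l v *~ a + l v' by rewrite raddfD /= raddfMz.
    exists (v *~ a + v'); rewrite !DMz; split=> //.
    by rewrite coinduced_addE valMz.
  - by have -> : v = 0; [apply: gI; rewrite -gv linear0 | rewrite linear0 val0].
have hw w : additive_pred (fun a => h (a *: w)).
  by apply/asboolP => a b; rewrite scalerDl raddfD.
pose k w : coinduced := Sub _ (hw w).
have kE w b : val (k w) b = h (b *: w) by rewrite SubK.
have klin : linear k.
  move=> a x y; apply: coinduced_eq => b.
  by rewrite coinduced_addE coinduced_scaleE !kE scalerDr raddfD scalerA.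
pose kL := GRing.isLinear.Build A W coinduced *:%R k klin.
exists (HB.pack k kL : {linear W -> coinduced}) => v.
apply: coinduced_eq => b; transitivity (val (k (g v)) b) => //; rewrite kE -linearZ.
rewrite (hG _ (val (f (b *: v)) 1)); last by exists (b *: v).
by rewrite linearZ coinduced_scaleE mul1r.
Qed.
End Coinduced.

Lemma enough_injectives (A : comNzRingType) (M : lmodType A) :
  exists (E : lmodType A) (i : {linear M -> E}), injective_module E /\ injective i.
Proof.
(* [G] is a product of copies of Q/Z indexed by all functions M -> Q/Z, which keeps it a plain
   function type; [ev] is set to 0 at the non-additive ones. *)
pose Q : zmodType := rat_mod_int; pose G : zmodType := (M -> Q) -> Q.
pose addi (phi : M -> Q) := `[< forall x y, phi (x + y) = phi x + phi y >].
pose ev (x : M) : G := fun phi => if addi phi then phi x else 0.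
have evD x y : ev (x + y) = ev x + ev y.
  apply/funext => phi; rewrite -[RHS]/(ev x phi + ev y phi) /ev.
  by have [/asboolP phiD|_] := boolP (addi phi); rewrite ?phiD ?addr0.
have iP x : additive_pred (fun a => ev (a *: x)).
  by apply/asboolP => a b; rewrite scalerDl evD.
pose i x : coinduced A G := Sub _ (iP x).
have iE x b : val (i x) b = ev (b *: x) by rewrite SubK.
have ilin : linear i.
  move=> a x y; apply: coinduced_eq => b.
  by rewrite coinduced_addE coinduced_scaleE !iE scalerDr evD scalerA.
pose iL := GRing.isLinear.Build A M (coinduced A G) *:%R i ilin.
exists (coinduced A G), (HB.pack i iL : {linear M -> coinduced A G}); split.
  apply: coinduced_injective; apply: divisible_injective => n y n0.
  have /choice[z zP] phi := @rat_mod_int_divisible n (y phi) n0.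
  exists z; apply/funext => phi; rewrite -zP.
  pose at_phi (f : G) : Q := f phi.
  have at_add : zmod_morphism at_phi by [].
  pose atA : {additive G -> Q} :=
    HB.pack at_phi (GRing.isZmodMorphism.Build G Q at_phi at_add).
  by rewrite -[LHS]/(atA (z *~ n)) raddfMz -[in RHS](intz n) scaler_int.
move=> x y /= ixy; apply/eqP; rewrite -subr_eq0; apply/negPn/negP => xy.
have [h] := @rat_mod_int_separates (zmodule M) (x - y) xy; case/eqP.
have hadd : addi h by apply/asboolP => a b; rewrite raddfD.
have ixy' : i x = i y := ixy.
have : val (i x) 1 h = val (i y) 1 h by rewrite ixy'.
rewrite !iE !scale1r /ev hadd => hxy; apply: etrans (raddfB h x y) _.
by apply/eqP; rewrite subr_eq0; apply/eqP.
Qed.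

(** * Homological dimensions *)

Section Dimension.
Variable A : comNzRingType.
Implicit Types M N K P E Z : lmodType A.

(** The strict bound lets inductions on the dimension start at the zero module. *)
Definition projdim_lt M n : Prop :=
  exists (P : nat -> lmodType A) (d : forall i, {linear P i.+1 -> P i})
         (e : {linear P 0 -> M}),
    projective_resolution d e /\ forall i, (n <= i)%N -> forall x : P i, x = 0.

Definition injdim_lt M n : Prop :=
  exists (E : nat -> lmodType A) (d : forall i, {linear E i -> E i.+1})
         (e : {linear M -> E 0}),
    injective_resolution d e /\ forall i, (n <= i)%N -> forall x : E i, x = 0.

Lemma finite_projdimP M : finite_projdim M <-> exists n, projdim_lt M n.
Proof.
split=> [[n H]|[n [P [d [e [res P0]]]]]]; first by exists n.+1.
by exists n, P, d, e; split=> // i /ltnW/P0.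
Qed.

Lemma finite_injdimP M : finite_injdim M <-> exists n, injdim_lt M n.
Proof.
split=> [[n H]|[n [E [d [e [res E0]]]]]]; first by exists n.+1.
by exists n, E, d, e; split=> // i /ltnW/E0.
Qed.

Lemma ker_lift (U V W : lmodType A) (f : {linear U -> V}) (g : {linear V -> W}) :
  (forall x, g (f x) = 0) ->
  exists f' : {linear U -> ker_module g}, forall x, val (f' x) = f x.
Proof.
move=> gf; have kf x : ker_pred g (f x) by apply/eqP.
pose h x : ker_module g := Sub (f x) (kf x).
have hE x : val (h x) = f x by rewrite SubK.
have hlin : linear h by move=> a x y; apply: val_inj; rewrite linearP !hE linearP.
by exists (HB.pack h (GRing.isLinear.Build A U _ *:%R h hlin) : {linear U -> ker_module g}).
Qed.

Lemma ker_exact (V W : lmodType A) (g : {linear V -> W}) :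
  exact_at (val : {linear ker_module g -> V}) g.
Proof.
move=> y; split=> [gy|[x <-]]; last exact/eqP/(valP x).
by have ky : ker_pred g y by [apply/eqP]; exists (Sub y ky : ker_module g); apply: SubK.
Qed.

Lemma trivial_projdim M : (forall x : M, x = 0) -> projdim_lt M 0.
Proof.
move=> M0; exists (fun=> M), (fun=> \0), idfun; split=> [|i _]; last exact: M0.
split=> [_ V W g f gS|y|y|i y].
- by exists \0 => x; rewrite (M0 x) !linear0.
- by exists y.
- by split=> _; [exists 0; rewrite (M0 y) | apply: M0].
- by split=> _; [exists 0; rewrite (M0 y) | apply: M0].
Qed.

Lemma trivial_injdim M : (forall x : M, x = 0) -> injdim_lt M 0.
Proof.
move=> M0; exists (fun=> M), (fun=> \0), idfun; split=> [|i _]; last exact: M0.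
split=> [_ V W g f gI|x y|y|i y].
- by exists \0 => x; rewrite (M0 (f x)).
- by [].
- by split=> _; [exists 0; rewrite (M0 y) | apply: M0].
- by split=> _; [exists 0; rewrite (M0 y) | apply: M0].
Qed.

Lemma projdim_extension K P M (f : {linear K -> P}) (g : {linear P -> M}) n :
  projective P -> injective f -> surjective g -> exact_at f g ->
  projdim_lt K n -> projdim_lt M n.+1.
Proof.
move=> projP fI gS fg [Q [d [e [[projQ eS d0e dd] Q0]]]].
pose P' i : lmodType A := if i is j.+1 then Q j else P.
pose d' i : {linear P' i.+1 -> P' i} :=
  match i return {linear P' i.+1 -> P' i} with 0 => f \o e | j.+1 => d j end.
exists P', d', g; split=> [|[|i] //]; last exact: Q0.
split=> // [[//|i]|y|[|i]]; [exact: projQ | | | exact: dd].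
  split=> [/fg[x <-]|[z <-]]; last by apply/fg; exists (e z).
  by have [z <-] := eS x; exists z.
move=> y; split=> [H|/d0e H]; last by rewrite /= H linear0.
by apply/d0e/fI; rewrite linear0.
Qed.

Lemma injdim_extension M E Z (f : {linear M -> E}) (g : {linear E -> Z}) n :
  injective_module E -> injective f -> surjective g -> exact_at f g ->
  injdim_lt Z n -> injdim_lt M n.+1.
Proof.
move=> injE fI gS fg [Q [d [e [[injQ eI ed dd] Q0]]]].
pose E' i : lmodType A := if i is j.+1 then Q j else E.
pose d' i : {linear E' i -> E' i.+1} :=
  match i return {linear E' i -> E' i.+1} with 0 => e \o g | j.+1 => d j end.
exists E', d', f; split=> [|[|i] //]; last exact: Q0.
split=> // [[//|i]|y|[|i]]; [exact: injQ | | | exact: dd].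
  split=> [H|/fg H]; last by rewrite /= H linear0.
  by apply/fg/eI; rewrite linear0.
move=> y; split=> [/ed[x <-]|[z <-]]; last by apply/ed; exists (g z).
by have [z <-] := gS x; exists z.
Qed.

Lemma syzygy M n : projdim_lt M n.+1 ->
  exists (K P : lmodType A) (f : {linear K -> P}) (g : {linear P -> M}),
    [/\ projective P, injective f, surjective g, exact_at f g & projdim_lt K n].
Proof.
move=> [P [d [e [[projP eS d0e dd] P0]]]].
have ed x : e (d 0%N x) = 0 by apply/d0e; exists x.
have [d0 d0E] := ker_lift ed.
exists (ker_module e), (P 0%N), val, e.
split; [exact: projP | exact: val_inj | exact: eS | exact: ker_exact | ].
exists (fun i => P i.+1), (fun i => d i.+1), d0; split=> [|i ni]; last exact: P0.
split=> // y.
  have /d0e[x xE] : e (val y) = 0 by apply/ker_exact; exists y.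
  by exists x; apply: val_inj; rewrite d0E.
split=> [H|/dd H]; first by apply/dd; rewrite -d0E H linear0.
by apply: val_inj; rewrite d0E H linear0.
Qed.

Lemma cosyzygy M n : injdim_lt M n.+1 ->
  exists (E Z : lmodType A) (f : {linear M -> E}) (g : {linear E -> Z}),
    [/\ injective_module E, injective f, surjective g, exact_at f g
      & injdim_lt Z n].
Proof.
move=> [E [d [e [[injE eI ed dd] E0]]]].
have dd0 x : d 1%N (d 0%N x) = 0 by apply/dd; exists x.
have [d0 d0E] := ker_lift dd0.
(* The cokernel of [e] is realised as the kernel of [d 1], which is the image of [d 0]. *)
exists (E 0%N), (ker_module (d 1%N)), e, d0; split=> //.
- move=> y; have /dd[x xE] : d 1%N (val y) = 0 by apply/ker_exact; exists y.
  by exists x; apply: val_inj; rewrite d0E.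
- move=> y; split=> [H|/ed H]; first by apply/ed; rewrite -d0E H linear0.
  by apply: val_inj; rewrite d0E H linear0.
exists (fun i => E i.+1), (fun i => d i.+1), val; split=> [|i ni]; last exact: E0.
split; [by [] | exact: val_inj | exact: ker_exact | by []].
Qed.

Section Vanishing.
Variables (n : nat -> nat) (D : forall j, 'M[A]_(n j, n j.+1)).
Hypothesis resD : forall j, D j *m D j.+1 = 0 /\ mx_exact (D j.+1) (D j) A^o.

(** Tor_{j+1}(coker (D 0), N) = 0. Dimension shifting in [N], while the other argument is resolved
    by [D], takes the place of the symmetry of Tor. *)
Lemma projdim_mx_exact N t j : projdim_lt N t -> (t <= j)%N ->
  mx_exact (D j.+1) (D j) N.
Proof.
elim: t N j => [|t IH] N j pdN.
  move: pdN => [P [d [e [[_ eS _ _] P0]]]] _ y _; exists 0; rewrite linear0.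
  apply/ffunP=> a; rewrite ffunE; have [x <-] := eS (y a).
  by rewrite (P0 0%N isT x) linear0.
case: j => // j tj; have [K [P [f [g [projP fI gS fg pdK]]]]] := syzygy pdN.
apply: (mx_exact_quot fI gS fg (proj1 (resD j)) (IH _ _ pdK tj)).
exact: projective_mx_exact projP (proj2 (resD j.+1)).
Qed.

Lemma tr_comp0 j : (D j.+1)^T *m (D j)^T = 0.
Proof. by rewrite -trmx_mul (proj1 (resD j)) trmx0. Qed.

Lemma injdim_mx_exact N t j : injdim_lt N t -> (t <= j)%N ->
  mx_exact (D j)^T (D j.+1)^T N.
Proof.
elim: t N j => [|t IH] N j idN.
  move: idN => [E [d [e [[_ eI _ _] E0]]]] _ y _; exists 0; rewrite linear0.
  by apply/ffunP=> a; rewrite ffunE; apply: eI; rewrite linear0; apply: (E0 0%N).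
case: j => // j tj; have [E [Z [f [g [injE fI gS fg idZ]]]]] := cosyzygy idN.
apply/mx_exactP; apply: (div_exact_sub fI gS fg (tr_comp0 j) (tr_comp0 j.+1)).
  exact/mx_exactP/(IH _ _ idZ tj).
exact: injective_mx_exact injE (proj2 (resD j.+1)).
Qed.
End Vanishing.
End Dimension.

(** * Vanishing of Tor and Ext from Koszul homology *)

Section KoszulVanishing.
Variables (A : comNzRingType) (n : nat -> nat) (D : forall j, 'M[A]_(n j, n j.+1)).
Hypothesis resD : forall j, D j *m D j.+1 = 0 /\ mx_exact (D j.+1) (D j) A^o.
Variables (M : lmodType A) (m : nat) (u : 'I_m -> A).
Hypothesis uD : forall k, exists S0, D 0 *m S0 = (u k)%:M.

Lemma trivial_mx_exact (N : lmodType A) p q r (E' : 'M[A]_(q, r)) (D' : 'M[A]_(p, q)) :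
  (forall x : N, x = 0) -> mx_exact E' D' N.
Proof. by move=> N0 y _; exists 0; rewrite linear0; apply/ffunP=> a; rewrite ffunE. Qed.

Lemma koszul_homology_trivial i (x : koszul_homology u M i) : (m < i)%N -> x = 0.
Proof.
move=> mi; have K0 (y : koszul m M i) : y = 0.
  apply/ffunP=> -[S cS]; exfalso; have := max_card (mem S).
  by rewrite card_ord (eqP cS) leqNgt mi.
rewrite -(quot_piK x); apply/quot_pi_eq0/asboolP; exists 0.
by rewrite linear0 [RHS]K0.
Qed.

Lemma uniform_bound (Q : nat -> nat -> Prop) : (forall i, exists t, Q i t) ->
  (forall i t t', (t <= t')%N -> Q i t -> Q i t') ->
  exists t, forall i, (i <= m)%N -> Q i t.
Proof.
move=> /choice[t tQ] Qle; exists (\max_(i < m.+1) t i)%N => i im.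
by apply: Qle (tQ i); rewrite -ltnS in im; apply: (leq_bigmax (Ordinal im)).
Qed.

Lemma koszul_homotopies : exists S : forall (k : 'I_m) j, 'M[A]_(n j.+1, n j),
  forall k j, D j.+1 *m S k j.+1 + S k j *m D j = (u k)%:M.
Proof.
have Sk k : {S : forall j, 'M[A]_(n j.+1, n j) |
    forall j, D j.+1 *m S j.+1 + S j *m D j = (u k)%:M}.
  by apply: cid; have [S [_ H]] := homotopies resD (uD k); exists S.
by exists (fun k => sval (Sk k)) => k; apply: (svalP (Sk k)).
Qed.

(* Tor_{j+1}(coker (D 0), M) = 0 for large j *)
Lemma koszul_tor_vanishing : (forall i, finite_projdim (koszul_homology u M i)) ->
  exists t, forall j, (t <= j)%N -> mx_exact (D j.+1) (D j) M.
Proof.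
move=> pdH.
pose Q i t := forall j, (t <= j)%N -> mx_exact (D j.+1) (D j) (koszul_homology u M i).
have [|i t t' tt' tQ j t'j|t tQ] := @uniform_bound Q; last first.
- have [S SP] := koszul_homotopies.
  (* [koszul_mx_exact] is applied to L_i = F_(j + 2 - i); differentials indexed
     by pairs of degrees avoid casts along this truncated subtraction. *)
  pose D2 a b : 'M[A]_(n a, n b) := if a.+1 =P b is ReflectT e
    then ecast b 'M[A]_(n a, n b) e (D a) else 0.
  pose S2 k a b : 'M[A]_(n b, n a) := if a.+1 =P b is ReflectT e
    then ecast b 'M[A]_(n b, n a) e (S k a) else 0.
  have D2E a : D2 a a.+1 = D a.
    by rewrite /D2; case: eqP => // e; rewrite (eq_irrelevance e erefl).
  have S2E k a : S2 k a a.+1 = S k a.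
    by rewrite /S2; case: eqP => // e; rewrite (eq_irrelevance e erefl).
  have DD2 a b c : D2 a b *m D2 b c = 0.
    have [<-|/eqP ab] := eqVneq a.+1 b; last first.
      by rewrite {1}/D2; case: eqP => // _; rewrite mul0mx.
    have [<-|/eqP bc] := eqVneq a.+2 c; first by rewrite !D2E; apply: (resD a).1.
    by rewrite {2}/D2; case: eqP => // _; rewrite mulmx0.
  have htpy k a b c : b = a.+1 -> c = b.+1 ->
      D2 b c *m S2 k b c + S2 k a b *m D2 a b = (u k)%:M.
    by move=> -> ->; rewrite !D2E !S2E.
  have ex2 N a b c : b = a.+1 -> c = b.+1 ->
      mx_exact (D a.+1) (D a) N -> mx_exact (D2 b c) (D2 a b) N.
    by move=> -> ->; rewrite !D2E.
  (* H_i is met with the matrices [D (j - i).+1] and [D (j - i)], where i <= m, so adding m keeps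
     [j - i] at least t. *)
  exists (t + m)%N => j tmj.
  have := @koszul_mx_exact A m u M (fun i => n (j.+2 - i)%N)
    (fun i => D2 (j.+2 - i.+1)%N (j.+2 - i)%N) (fun i => DD2 _ _ _)
    (fun k i => S2 k (j.+2 - i.+1)%N (j.+2 - i)%N).
  have e1 : (j.+2 - 1 = j.+1)%N by rewrite subn1.
  have e2 : (j.+2 - 2 = j)%N by rewrite !subSS subn0.
  rewrite /= e1 e2 subn0 !D2E; apply=> [k i im|i].
    by apply: htpy; lia.
  have [im|mi] := leqP i m; last first.
    by apply: trivial_mx_exact => x; apply: koszul_homology_trivial.
  by apply: ex2; [lia | lia | apply: tQ; lia].
- by apply: tQ; apply: leq_trans t'j.
- move=> i; have /finite_projdimP[t pdt] := pdH i.
  by exists t => j; apply: projdim_mx_exact.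
Qed.

(* Ext^{j+1}(coker (D 0), M) = 0 for large j *)
Lemma koszul_ext_vanishing : (forall i, finite_injdim (koszul_homology u M i)) ->
  exists t, forall j, (t <= j)%N -> mx_exact (D j)^T (D j.+1)^T M.
Proof.
move=> idH.
pose Q i t := forall j, (t <= j)%N -> mx_exact (D j)^T (D j.+1)^T (koszul_homology u M i).
have [|i t t' tt' tQ j t'j|t tQ] := @uniform_bound Q; last first.
(* Here H_i is met in degree [i + j], so t itself suffices. *)
- have [S SP] := koszul_homotopies; exists t => j tj.
  apply: (@koszul_mx_exact A m u M (fun i => n (i + j)%N) (fun i => (D (i + j))^T)
    (fun i => tr_comp0 resD (i + j)) (fun k i => (S k (i + j))^T)) => [k i _|i].
    by rewrite -!trmx_mul -linearD /= addrC SP tr_scalar_mx.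
  have [im|mi] := leqP i m; last first.
    by apply: trivial_mx_exact => x; apply: koszul_homology_trivial.
  by apply: (tQ i im (i + j)%N); apply: leq_trans tj (leq_addl _ _).
- by apply: tQ; apply: leq_trans t'j.
- move=> i; have /finite_injdimP[t idt] := idH i.
  by exists t => j; apply: injdim_mx_exact.
Qed.
End KoszulVanishing.

(** * Presentations of A/J *)

Section Generators.
Variable A : comNzRingType.

(* D presents A/J: its single row lists generators of J. *)
Definition presents (J : {pred A}) p q (D : 'M[A]_(p, q)) : Prop :=
  exists (v : 'I_q -> A) (i0 : 'I_p),
    [/\ generated_by J v setT, forall i, i = i0 & forall i j, D i j = v j].

Lemma presents_exists (J : {pred A}) : noetherian A -> ideal J ->
  exists q (D : 'M[A]_(1, q)), presents J D.
Proof.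
move=> noethA /noethA[q [v vJ]]; exists q, (\row_j v j), v, ord0; split=> // i.
  exact: ord1.
by move=> j; rewrite mxE.
Qed.

Lemma generated_sum (J : {pred A}) q (v : 'I_q -> A) : generated_by J v setT ->
  forall b, b \in J -> exists c : {ffun 'I_q -> A^o}, b = \sum_k c k * v k.
Proof.
move=> vJ b /vJ[c ->]; exists [ffun k => c k].
rewrite (eq_bigl _ _ (fun k => in_setT k)).
by apply: eq_bigr => k _; rewrite ffunE.
Qed.

Lemma presents_factor (J : {pred A}) p q (D : 'M[A]_(p, q)) b :
  presents J D -> b \in J -> exists S0, D *m S0 = b%:M.
Proof.
move=> [v [i0 [vJ i0E Dv]]] /(generated_sum vJ)[c ->].
exists (\matrix_(j, i) c j); apply/matrixP=> i i'.
rewrite !mxE (i0E i) (i0E i') eqxx mulr1n; apply: eq_bigr => j _.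
by rewrite mxE Dv mulrC.
Qed.

Lemma hom_on_sum (J : {pred A}) (N : lmodType A) (phi : A -> N) (I : finType)
    (c v : I -> A) : ideal J -> hom_on J phi -> (forall k, v k \in J) ->
  phi (\sum_k c k * v k) = \sum_k c k *: phi (v k).
Proof.
move=> idJ phiJ vJ.
suff [] : \sum_k c k * v k \in J /\ phi (\sum_k c k * v k) = \sum_k c k *: phi (v k) by [].
apply: (big_ind2 (fun b y => b \in J /\ phi b = y)).
- by split; [case: idJ | apply: hom_on0 phiJ].
- move=> b _ b' _ [bJ <-] [b'J <-]; have := phiJ 1 b b' bJ b'J.
  rewrite mul1r scale1r => ->; split=> //.
  by have := idJ.2 1 b b' bJ b'J; rewrite scale1r.
move=> k _; have := phiJ (c k) (v k) 0 (vJ k) idJ.1.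
rewrite !addr0 (hom_on0 idJ phiJ) addr0 => ->; split=> //.
by have := idJ.2 (c k) _ _ (vJ k) idJ.1; rewrite addr0.
Qed.

Section Presentation.
Variables (J : {pred A}) (N : lmodType A) (p q r : nat).
Variables (E : 'M[A]_(q, r)) (D : 'M[A]_(p, q)).
Hypothesis idJ : ideal J.

Lemma hom_on_relations (phi : A -> N) (v : 'I_q -> A) (i0 : 'I_p) :
  hom_on J phi -> (forall j, v j \in J) -> (forall j, D i0 j = v j) ->
  D *m E = 0 -> act E^T [ffun j => phi (v j)] = 0.
Proof.
move=> phiJ vJ Dv /matrixP DE0; apply/ffunP=> k; rewrite !ffunE.
transitivity (phi (\sum_j E j k * v j)).
  rewrite (hom_on_sum _ idJ phiJ vJ); apply: eq_bigr => j _.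
  by rewrite mxE ffunE.
rewrite -(hom_on0 idJ phiJ); congr phi.
have := DE0 i0 k; rewrite !mxE => DEk; rewrite -[RHS]DEk.
by apply: eq_bigr => j _; rewrite Dv mulrC.
Qed.

(** The values of [phi] on the generators of [J] form a cocycle; being a coboundary means that they
    are the multiples v_j z of one element z. *)
Lemma exact_hom_extends : presents J D -> D *m E = 0 -> mx_exact D^T E^T N -> hom_extends J N.
Proof.
move=> [v [i0 [vJ i0E Dv]]] DE0 ex phi phiJ.
have vmem := generated_mem vJ.
have [|z zE] := ex [ffun j => phi (v j)].
  exact: hom_on_relations phiJ vmem (Dv i0) DE0.
exists (z i0) => b /(generated_sum vJ)[c ->]; rewrite (hom_on_sum _ idJ phiJ vmem).
rewrite scaler_suml; apply: eq_bigr => j _.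
move/ffunP: zE => /(_ j); rewrite !ffunE => ->.
rewrite (bigD1 i0) //= mxE Dv big1 ?addr0 ?scalerA // => i.
by rewrite (i0E i) eqxx.
Qed.

Lemma hom_div_exact (x : A) : presents J D -> D *m E = 0 -> mx_exact E D A^o ->
  (forall phi : A -> N, hom_on J phi -> exists (phi' : A -> N) z,
     hom_on J phi' /\ forall b, b \in J -> phi b = x *: phi' b + b *: z) ->
  div_exact x D^T E^T N.
Proof.
move=> [v [i0 [vJ i0E Dv]]] DE0 exA div y Ey.
have vmem := generated_mem vJ.
(* The cocycle [y] defines a homomorphism sending v_k to [y k]: by exactness over [A] the columns of
   [E] generate all relations among the v_k, and [y] respects them. *)
have ev0 (c c' : {ffun 'I_q -> A^o}) : \sum_k c k * v k = \sum_k c' k * v k ->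
    \sum_k c k *: y k = \sum_k c' k *: y k.
  move=> cc'; apply/eqP; rewrite -subr_eq0 -sumrB; apply/eqP.
  transitivity (\sum_k (c - c') k *: y k).
    by apply: eq_bigr => k _; rewrite !ffunE scalerBl.
  apply: (pairing_eq0 exA _ Ey); apply/ffunP=> i; rewrite linearB !ffunE.
  apply/eqP; rewrite subr_eq0; apply/eqP.
  transitivity (\sum_k c k * v k).
    by apply: eq_bigr => k _; rewrite Dv; apply: mulrC.
  by rewrite cc'; apply: eq_bigr => k _; rewrite Dv; apply: mulrC.
have /choice[C CP] b : exists c : {ffun 'I_q -> A^o},
    b \in J -> b = \sum_k c k * v k.
  have [bJ|_] := boolP (b \in J); last by exists 0.
  by have [c cE] := generated_sum vJ bJ; exists c.
pose phi b : N := \sum_k C b k *: y k.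
have phiE c : phi (\sum_k c k * v k) = \sum_k c k *: y k.
  rewrite /phi (ev0 _ [ffun k => c k]).
    by apply: eq_bigr => k _; rewrite ffunE.
  rewrite -CP; last exact: ideal_sum.
  by apply: eq_bigr => k _; rewrite ffunE.
have [|phi' [z [phi'J zP]]] := div phi.
  move=> a b c bJ cJ; rewrite {1}(CP b bJ) {1}(CP c cJ).
  rewrite mulr_sumr -big_split /=.
  rewrite (eq_bigr (fun k => (a * C b k + C c k) * v k)) => [|k _].
    rewrite phiE scaler_sumr -big_split; apply: eq_bigr => k _ /=.
    by rewrite scalerDl scalerA.
  by rewrite mulrDl mulrA.
exists [ffun j => phi' (v j)], [ffun=> z]; split.
  exact: hom_on_relations phi'J vmem (Dv i0) DE0.
apply/ffunP=> j; rewrite !ffunE (bigD1 i0) //= mxE Dv ffunE.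
rewrite big1 ?addr0 => [|i]; last by rewrite (i0E i) eqxx.
rewrite -zP // -[v j]mul1r.
have -> : 1 * v j = \sum_k (k == j)%:R * v k.
  by rewrite (bigD1 j) //= eqxx big1 ?addr0 // => k /negPf->; rewrite mul0r.
rewrite phiE (bigD1 j) //= eqxx scale1r big1 ?addr0 // => k /negPf->.
by rewrite scale0r.
Qed.
End Presentation.
End Generators.

(** * From vanishing of Tor to finite projective dimension *)

Section FiniteGeneration.
Variable A : comNzRingType.

Lemma fin_gen_surj (M N : lmodType A) (f : {linear M -> N}) :
  surjective f -> fin_gen_module M -> fin_gen_module N.
Proof.
move=> fS [n [x xM]]; exists n, (f \o x) => y; have [z <-] := fS y.
have [c ->] := xM z; exists c; rewrite linear_sum.
by apply: eq_bigr => k _; rewrite linearZ.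
Qed.

Lemma fin_gen_ker (V W : lmodType A) (g : {linear V -> W}) :
  noetherian A -> fin_gen_module V -> fin_gen_module (ker_module g).
Proof.
move=> noethA /fin_gen_moduleP[s sV].
have [||t [tB Bt]] := @noetherian_sub A V (fun y => g y = 0) s noethA.
- split=> [|a x y gx gy]; first exact: linear0.
  by rewrite linearP gx gy scaler0 addr0.
- by move=> y _; apply: sV.
pose t' : seq (ker_module g) := pmap insub t.
apply/fin_gen_moduleP; exists t' => y.
have gy : g (val y) = 0 by apply/eqP; exact: (valP y).
have [sub0 subD] := span_submodule t'.
suff [k /val_inj <-] : exists2 k, val k = val y & span t' k by [].
apply: (span_min (B := fun v => exists2 k, val k = v & span t' k)) (Bt _ gy).
  split=> [|a _ _ [k <- kt] [k' <- k't]]; first by exists 0; rewrite ?linear0.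
  by exists (a *: k + k'); [rewrite linearP | apply: subD].
move=> x xt; have gx : ker_pred g x by apply/eqP/tB.
exists (Sub x gx : ker_module g); first exact: SubK.
by apply: span_mem; rewrite mem_pmap_sub SubK.
Qed.

(** The homology H is a quotient of a submodule of N^q, hence finitely generated, and the hypothesis
    reads H = x H. *)
Lemma div_exact_nakayama (mm : {pred A}) (noethA : noetherian A)
    (localA : local_ring mm) (N : lmodType A) p q r (E : 'M[A]_(q, r))
    (D : 'M[A]_(p, q)) x :
  fin_gen_module N -> x \in mm -> div_exact x E D N -> mx_exact E D N.
Proof.
move=> fgN xm ex y Dy.
pose g : {linear {ffun 'I_q -> N} -> {ffun 'I_p -> N}} := @act A p q D N.
pose f : {linear {ffun 'I_r -> N} -> {ffun 'I_q -> N}} := @act A q r E N.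
pose pi : {linear ker_module g -> homology f g} :=
  quot_pi (boundary_submod_closed f g).
have pi0 k : pi k = 0 <-> exists z, act E z = val k.
  apply: iff_trans (quot_pi_eq0 (boundary_submod_closed f g) k) _.
  by split=> [/asboolP|H]; last exact/asboolP.
have piS : surjective pi by move=> z; exists (repr z); apply: quot_piK.
have fgH : fin_gen_module (homology f g).
  exact: fin_gen_surj piS (fin_gen_ker g noethA (fin_gen_ffun q fgN)).
have H0 := nakayama noethA localA fgH.
have [k ky] : exists k : ker_module g, val k = y by apply/(ker_exact g).
have /pi0[z zE] : pi k = 0; last by exists z; rewrite zE.
apply: H0 => h; have [w <-] := piS h.
have [y' [z [Dy' wE]]] : exists y' z, act D y' = 0 /\ val w = x *: y' + act E z.
  by apply: ex; apply/(ker_exact g); exists w.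
have [k' k'y] : exists k : ker_module g, val k = y' by apply/(ker_exact g).
exists 1%N, (fun=> x), (fun=> pi k'); split=> //; rewrite big_ord1.
apply/eqP; rewrite -subr_eq0 -linearZ -linearB; apply/eqP/pi0; exists z.
by rewrite linearB linearZ /= wE k'y scalerN addrC addKr.
Qed.
End FiniteGeneration.

Section FiniteProjdim.
Variables (A : comNzRingType) (mm : {pred A}).
Hypotheses (noethA : noetherian A) (localA : local_ring mm).

Definition lincomb n (N : lmodType A) (x : 'I_n -> N) (c : {ffun 'I_n -> A^o}) : N :=
  \sum_k c k *: x k.

Fact lincomb_is_linear n (N : lmodType A) (x : 'I_n -> N) : linear (lincomb x).
Proof.
move=> a c c'; rewrite /lincomb scaler_sumr -big_split; apply: eq_bigr => k _ /=.
by rewrite !ffunE scalerDl scalerA.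
Qed.
HB.instance Definition _ n (N : lmodType A) (x : 'I_n -> N) :=
  GRing.isLinear.Build A {ffun 'I_n -> A^o} N *:%R (lincomb x) (lincomb_is_linear x).

Lemma free_projective n : projective {ffun 'I_n -> A^o}.
Proof.
move=> V W g f gS.
pose dl (k : 'I_n) : {ffun 'I_n -> A^o} := [ffun l => (l == k)%:R].
have /choice[v vE] k := gS (f (dl k)).
exists (lincomb v) => c; rewrite linear_sum.
have {2}-> : c = \sum_k c k *: dl k.
  apply/ffunP=> l; rewrite sum_ffunE (bigD1 l) //= !ffunE eqxx.
  rewrite big1 ?addr0 => [|k kl]; first by rewrite -[LHS]mulr1.
  by rewrite !ffunE eq_sym (negPf kl) scaler0.
by rewrite linear_sum; apply: eq_bigr => k _; rewrite !linearZ /= vE.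
Qed.

Variables (n : nat -> nat) (D : forall j, 'M[A]_(n j, n j.+1)).
Hypothesis resD : forall j, D j *m D j.+1 = 0 /\ mx_exact (D j.+1) (D j) A^o.
Hypothesis DJ : presents mm (D 0).

(* With minimal generators, the first syzygy K lies in mm P, and exactness
   turns this into K = mm K. *)
Lemma minimal_syzygy_trivial p (M : lmodType A) (x : 'I_p -> M) :
  surjective (lincomb x) -> (forall c, lincomb x c = 0 -> forall k, c k \in mm) ->
  mx_exact (D 1) (D 0) M ->
  forall k : ker_module (lincomb x), k = 0.
Proof.
move=> xS xmin ex; have [v [i0 [vJ i0E Dv]]] := DJ.
set e : {linear {ffun 'I_p -> A^o} -> M} := lincomb x.
have [vl vlE] : exists vl : {linear ker_module e -> {ffun 'I_p -> A^o}},
    forall k, vl k = val k by exists val.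
have vlI : injective vl by move=> a b; rewrite !vlE; apply: val_inj.
have ker_vl : exact_at vl e.
  move=> y; apply: iff_trans (ker_exact e y) _.
  by split=> -[k <-]; exists k; rewrite vlE.
have evl k : e (vl k) = 0 by apply/ker_vl; exists k.
have fgK : fin_gen_module (ker_module e).
  exact: fin_gen_ker noethA (fin_gen_ffun p (fin_gen_regular A)).
apply: (nakayama noethA localA fgK) => k.
have /choice[c cP] a : exists c : {ffun 'I_(n 1) -> A^o}, vl k a = \sum_j c j * v j.
  apply: (generated_sum vJ); apply: xmin; exact: evl.
pose w : {ffun 'I_(n 1) -> {ffun 'I_p -> A^o}} := [ffun j => [ffun a => c a j]].
have Dw : act (D 0) w = fmap vl [ffun=> k].
  apply/ffunP=> i; apply/ffunP=> a; rewrite !ffunE sum_ffunE cP.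
  by apply: eq_bigr => j _; rewrite !ffunE Dv; apply: mulrC.
(* [w] writes [k] with coefficients in the free module. Its image in [M] is a cycle, hence a
   boundary, and subtracting the lifted boundary moves the coefficients into the kernel without
   changing [k]. *)
have [|z' ew] := ex (fmap e w); first by rewrite act_fmap Dw fmap_comp0.
have [z zE] : exists z, fmap e z = z' by apply: fmap_lift => a; apply: xS.
have [q qE] : exists q, fmap vl q = w - act (D 1) z.
  apply: (exact_fmap ker_vl); by rewrite linearB /= ew -zE act_fmap subrr.
have Dq : act (D 0) q = [ffun=> k].
  apply: (fmap_inj vlI); rewrite -act_fmap qE linearB /= Dw.
  by rewrite act_comp0 ?subr0 //; apply: (resD 0).1.
exists (n 1), (D 0 i0), q; split=> [j|]; first by rewrite Dv; apply: generated_mem.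
by move/ffunP: Dq => /(_ i0); rewrite !ffunE.
Qed.

(** Passing to a syzygy lowers the degree from which Tor vanishes; at t = 0 already Tor_1(k, M) = 0
    and [M] is free. *)
Lemma tor_vanishing_projdim t (M : lmodType A) : fin_gen_module M ->
  (forall j, (t <= j)%N -> mx_exact (D j.+1) (D j) M) -> exists s, projdim_lt M s.
Proof.
elim: t M => [|t IH] M fgM ex.
  have [p [x [gen xmin]]] := minimal_generators noethA localA fgM.
  have xS : surjective (lincomb x).
    move=> y; have [c ->] := gen y; exists [ffun k => c k].
    by apply: eq_bigr => k _; rewrite ffunE.
  exists 1%N; apply: (projdim_extension (@free_projective p) val_inj xS).
    exact: ker_exact.
  apply/trivial_projdim/minimal_syzygy_trivial => // [c /xmin//|].
  exact: ex.
have [p [x gen]] := fgM.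
have xS : surjective (lincomb x).
  move=> y; have [c ->] := gen y; exists [ffun k => c k].
  by apply: eq_bigr => k _; rewrite ffunE.
have kerE := @ker_exact A _ _ (lincomb x).
have [||s pds] := IH (ker_module (lincomb x)).
- exact: fin_gen_ker noethA (fin_gen_ffun p (fin_gen_regular A)).
- move=> j tj; apply/mx_exactP.
  apply: (div_exact_sub val_inj xS kerE (resD j.+1).1 (resD j).1).
    exact/mx_exactP/ex.
  exact: projective_mx_exact (@free_projective p) (resD j).2.
by exists s.+1; apply: (projdim_extension (@free_projective p) val_inj xS kerE).
Qed.
End FiniteProjdim.

(** * From vanishing of Ext to finite injective dimension *)

Section FiniteInjdim.
Variables (A : comNzRingType) (mm : {pred A}).
Hypotheses (noethA : noetherian A) (localA : local_ring mm).

Definition cosyzygy_of (M Z : lmodType A) : Prop :=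
  exists (E : lmodType A) (f : {linear M -> E}) (g : {linear E -> Z}),
    [/\ injective_module E, injective f, surjective g & exact_at f g].

Lemma cosyzygy_exists (M : lmodType A) : exists Z, cosyzygy_of M Z.
Proof.
have [E [f [injE fI]]] := enough_injectives M.
pose B : {pred E} := fun y => `[< exists x, f x = y >].
have subB : submod_closed B.
  split=> [|a y z /asboolP[x <-] /asboolP[x' <-]]; apply/asboolP.
    by exists 0; rewrite linear0.
  by exists (a *: x + x'); rewrite linearP.
exists (quot_module subB), E, f, (quot_pi subB); split=> // [z|y].
  by exists (repr z); apply: quot_piK.
apply: iff_trans (quot_pi_eq0 subB y) _.
by split=> [/asboolP|H]; last exact/asboolP.
Qed.

(** Ext^1 of 0 -> A/(J : x) -> A/J -> A/(J + x) -> 0. Concretely, [phi] restricted to multiples of x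
    is b x |-> b z, so it extends to J + (x) by sending x to z, and from there to [A]. *)
Lemma colon_hom_extends (J : {pred A}) (N : lmodType A) x :
  ideal J ->
  hom_extends (fun b => b * x \in J) N ->
  hom_extends (fun c => `[< exists b, c - b * x \in J >]) N ->
  hom_extends J N.
Proof.
move=> idJ extC extS phi phiJ; have [J0 JD] := idJ.
have [a b c bx cx|z zE] := extC (fun b => phi (b * x)).
  by rewrite mulrDl -mulrA; apply: phiJ.
have /choice[B BP] c : exists b, (exists b, c - b * x \in J) -> c - b * x \in J.
  by have [[b bP]|nb] := lem (exists b, c - b * x \in J); [exists b | exists 0 => /nb].
pose psi c := phi (c - B c * x) + B c *: z.
have psiE c b : c - b * x \in J -> psi c = phi (c - b * x) + b *: z.
  move=> cb; have cB : c - B c * x \in J by apply: BP; exists b.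
  have bB : (b - B c) * x \in J.
    have := JD (-1) _ _ cb cB; rewrite scaleN1r opprB mulrBl.
    by rewrite addrA subrK.
  rewrite /psi; have -> : c - B c * x = 1 * (c - b * x) + (b - B c) * x.
    by rewrite mul1r mulrBl addrA subrK.
  by rewrite phiJ // scale1r zE // scalerBl -addrA subrK.
have [|w wE] := extS psi; last first.
  exists w => b bJ; rewrite -wE.
    by rewrite (psiE b 0) mul0r subr0 ?scale0r ?addr0.
  by apply/asboolP; exists 0; rewrite mul0r subr0.
move=> a b c /asboolP[b' bb'] /asboolP[c' cc'].
have E : a * b + c - (a * b' + c') * x = a * (b - b' * x) + (c - c' * x).
  by rewrite mulrDl mulrBr opprD addrACA mulrA.
rewrite (psiE _ (a * b' + c')) E; last exact: JD.
rewrite phiJ // (psiE b b') // (psiE c c') //.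
by rewrite scalerDr scalerDl scalerA addrACA.
Qed.

(* If x is regular modulo J, then multiplication by x is surjective on
   Ext^1(A/J, N) as soon as Ext^1(A/(J + x), Z) = 0 for the cosyzygy Z. *)
Lemma regular_hom_div (J : {pred A}) (N Z : lmodType A) x :
  ideal J -> cosyzygy_of N Z -> (forall b, b * x \in J -> b \in J) ->
  hom_extends (fun c => `[< exists b, c - b * x \in J >]) Z ->
  forall phi : A -> N, hom_on J phi -> exists (phi' : A -> N) z,
    hom_on J phi' /\ forall b, b \in J -> phi b = x *: phi' b + b *: z.
Proof.
move=> idJ [E [f [g [injE fI gS fg]]]] xreg extS phi phiJ; have [J0 JD] := idJ.
have [|e eE] := injective_hom_extends injE idJ (phi := f \o phi).
  by move=> a b c bJ cJ; rewrite /= phiJ // linearP.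
have Jge b : b \in J -> b *: g e = 0.
  by move=> bJ; rewrite -linearZ -eE //; apply/fg; exists (phi b).
have /choice[B BP] c : exists b, (exists b, c - b * x \in J) -> c - b * x \in J.
  by have [[b bP]|nb] := lem (exists b, c - b * x \in J); [exists b | exists 0 => /nb].
(* The homomorphism on J + (x) that kills J and sends x to [g e]. It is well defined because x is
   regular modulo J and J annihilates [g e]. *)
pose psi c := B c *: g e.
have psiE c b : c - b * x \in J -> psi c = b *: g e.
  move=> cb; have cB : c - B c * x \in J by apply: BP; exists b.
  apply/eqP; rewrite -subr_eq0 -scalerBl; apply/eqP/Jge/xreg.
  have := JD (-1) _ _ cB cb; rewrite scaleN1r opprB mulrBl.
  by rewrite addrA subrK.
have [|w wE] := extS psi.
  move=> a b c /asboolP[b' bb'] /asboolP[c' cc'].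
  rewrite (psiE _ (a * b' + c')) ?(psiE b b') ?(psiE c c') //.
    by rewrite scalerDl scalerA.
  have -> : a * b + c - (a * b' + c') * x = a * (b - b' * x) + (c - c' * x).
    by rewrite mulrDl mulrBr opprD addrACA mulrA.
  exact: JD.
have JSx b : b \in J -> `[< exists b', b - b' * x \in J >].
  by move=> bJ; apply/asboolP; exists 0; rewrite mul0r subr0.
have Jw b : b \in J -> b *: w = 0.
  by move=> bJ; rewrite -wE ?(psiE b 0) ?scale0r ?mul0r ?subr0 //; apply: JSx.
have xw : x *: w = g e.
  rewrite -wE ?(psiE x 1) ?scale1r ?mul1r ?subrr //.
  by apply/asboolP; exists 1; rewrite mul1r subrr.
have [e' e'w] := gS w.
have /choice[phi' phi'E] b : exists y, b \in J -> f y = b *: e'.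
  have [bJ|_] := boolP (b \in J); last by exists 0.
  by have /fg[y yE] : g (b *: e') = 0; [rewrite linearZ /= e'w Jw | exists y].
(* Inside [E], [phi b] is b e = x (b e') + b (e - x e'), and both b e' and e - x e' lie in the image
   of [f]. *)
have /fg[z zE] : g (e - x *: e') = 0 by rewrite linearB linearZ /= e'w xw subrr.
exists phi', z; split=> [a b c bJ cJ|b bJ]; apply: fI.
  rewrite linearP !phi'E ?scalerDl ?scalerA //.
  exact: JD.
rewrite linearD !linearZ /= phi'E // zE scalerBr.
by rewrite !scalerA mulrC addrC subrK -eE.
Qed.

Section Tower.
Variables (Z : nat -> lmodType A).
Hypothesis ZS : forall i, cosyzygy_of (Z i) (Z i.+1).
Variables (n : nat -> nat) (D : forall j, 'M[A]_(n j, n j.+1)).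
Hypothesis resD : forall j, D j *m D j.+1 = 0 /\ mx_exact (D j.+1) (D j) A^o.

(** Ext^{i+j+1}(-, Z 0) = 0 gives Ext^{j+1}(-, Z i) = 0, one cosyzygy at a time; [tower_shift_down]
    goes back and also transports divisibility by [x]. *)
Lemma tower_shift_up i j :
  mx_exact (D (i + j)%N)^T (D (i + j).+1)^T (Z 0) ->
  mx_exact (D j)^T (D j.+1)^T (Z i).
Proof.
elim: i j => // i IH j ex; have [E [f [g [injE fI gS fg]]]] := ZS i.
apply: (mx_exact_quot fI gS fg (tr_comp0 resD j.+1)).
  by apply: IH; rewrite addnS.
exact: injective_mx_exact injE (resD j).2.
Qed.

Lemma tower_shift_down x i j :
  div_exact x (D j)^T (D j.+1)^T (Z i) ->
  div_exact x (D (i + j)%N)^T (D (i + j).+1)^T (Z 0).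
Proof.
elim: i j => // i IH j ex; have [E [f [g [injE fI gS fg]]]] := ZS i.
rewrite addSnnS; apply: IH.
apply: (div_exact_sub fI gS fg (tr_comp0 resD j) (tr_comp0 resD j.+1) ex).
exact: injective_mx_exact injE (resD j.+1).2.
Qed.
End Tower.

Lemma hom_extends_eq (J J' : {pred A}) N : J =i J' ->
  hom_extends J N -> hom_extends J' N.
Proof.
move=> JJ' ext phi phiJ; have [a b c|z zE] := ext phi; last first.
  by exists z => b; rewrite -JJ'; apply: zE.
by rewrite !JJ'; apply: phiJ.
Qed.

Lemma ext_vanishing_injdim (n : nat -> nat) (D : forall j, 'M[A]_(n j, n j.+1))
    t (M : lmodType A) :
  (forall j, D j *m D j.+1 = 0 /\ mx_exact (D j.+1) (D j) A^o) ->
  presents mm (D 0) -> fin_gen_module M ->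
  (forall j, (t <= j)%N -> mx_exact (D j)^T (D j.+1)^T M) ->
  exists s, injdim_lt M s.
Proof.
move=> resD Dm fgM exM.
have /choice[next nextP] := cosyzygy_exists.
pose Z i := iter i next M; have ZS i : cosyzygy_of (Z i) (Z i.+1) by apply: nextP.
(* All i >= t are treated at once, because the regular case at i uses the ideal J + (x) at i + 1. *)
have ext : forall J, ideal J -> forall i, (t <= i)%N -> hom_extends J (Z i).
  apply: (noetherian_ind noethA) => J idJ IH i ti; have [J0 JD] := idJ.
  have [J1|J1] := boolP (1 \in J).
    move=> phi phiJ; exists (phi 1) => b _.
    by have := phiJ b 1 0 J1 J0; rewrite (hom_on0 idJ phiJ) !addr0 mulr1.
  have Jm := proper_sub_mm noethA localA idJ J1.
  have [mJ|nmJ] := lem {subset mm <= J}.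
    apply: (@hom_extends_eq mm) => [x|]; first by apply/idP/idP; [apply: mJ | apply: Jm].
    apply: (exact_hom_extends (mm_ideal localA) Dm (resD 0).1).
    by apply: (tower_shift_up ZS resD); rewrite addn0; apply: exM.
  have [x xm xJ] : exists2 x, x \in mm & x \notin J.
    apply: contrapT => H; apply: nmJ => x xm; apply/negPn/negP => xJ.
    by apply: H; exists x.
  pose S : {pred A} := fun c => `[< exists b, c - b * x \in J >].
  have extS k : (t <= k)%N -> hom_extends S (Z k).
    apply: IH.
    - split=> [|a b c /asboolP[b' bb'] /asboolP[c' cc']]; apply/asboolP.
        by exists 0; rewrite mul0r subr0.
      exists (a * b' + c'); have := JD a _ _ bb' cc'; congr (_ \in J).
      rewrite -[a *: b]/(a * b) -[a *: (b - _)]/(a * (b - _)).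
      by rewrite mulrBr mulrDl opprD addrACA mulrA.
    - by move=> b bJ; apply/asboolP; exists 0; rewrite mul0r subr0.
    - by exists x => //; apply/asboolP; exists 1; rewrite mul1r subrr.
  have [[b bx bJ]|xreg] := lem (exists2 b, b * x \in J & b \notin J).
    apply: (colon_hom_extends (x := x) idJ); last exact: extS.
    apply: IH => //; last by exists b.
    - split=> [|a c c' cx c'x]; first by rewrite unfold_in mul0r.
      by rewrite unfold_in mulrDl -mulrA; apply: JD.
    - by move=> c cJ; have := JD x c 0 cJ J0; rewrite addr0 unfold_in mulrC.
  have [q [D0 D0J]] := presents_exists noethA idJ.
  have [n' [D' [/(_ (presents J) D0J) D'J resD']]] := free_resolution noethA D0.
  apply: (exact_hom_extends idJ D'J (resD' 0).1).
  (* [Z i] need not be finitely generated. The question is moved to [M] in degree i + 1 for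
     Nakayama, and the divisibility needed there comes from [Z i] in degree 1. *)
  apply: (tower_shift_up ZS resD'); rewrite addn0.
  apply: (div_exact_nakayama noethA localA fgM xm).
  rewrite -[i]addn0; apply: (tower_shift_down ZS resD').
  apply: (hom_div_exact idJ D'J (resD' 0).1 (resD' 0).2).
  apply: (regular_hom_div idJ (ZS i)); last exact: extS (leqW ti).
  move=> b bx; apply/negPn/negP => bJ; apply: xreg; by exists b.
have injZ : injective_module (Z t).
  by apply/injective_extension/baer_extension => J idJ; apply: ext.
have idZ : exists s, injdim_lt (Z t) s.
  pose O := {ffun 'I_0 -> A^o}.
  have O0 (x : O) : x = 0 by apply/ffunP=> -[].
  exists 1%N; apply: (@injdim_extension A (Z t) (Z t) O idfun \0) => //.
  - by move=> y; exists 0; rewrite (O0 y).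
  - by move=> y; split=> // _; exists y.
  - exact: trivial_injdim.
(* Descend from [Z t] to [Z 0], which is [M], adding one injective module per cosyzygy. *)
elim: {injZ} t idZ {exM ext} => // i IH [s ids]; apply: IH.
have [E [f [g [injE fI gS fg]]]] := ZS i.
by exists s.+1; apply: (injdim_extension injE fI gS fg ids).
Qed.
End FiniteInjdim.

Theorem theorem1p5 (A : comNzRingType) (mm : {pred A})
    (noethA : noetherian A) (localA : local_ring mm)
    (M : lmodType A) (fgM : fin_gen_module M)
    (I : {pred A}) (properI : idealr_closed I)
    (m : nat) (u : 'I_m -> A) (minu : minimal_generating I u) :
  ((forall i : nat, finite_projdim (koszul_homology u M i)) ->
     finite_projdim M)
  /\
  ((forall i : nat, finite_injdim (koszul_homology u M i)) ->
     finite_injdim M).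
Proof.
have [q [D0 D0m]] := presents_exists noethA (mm_ideal localA).
have [n [D [/(_ (presents mm) D0m) Dm resD]]] := free_resolution noethA D0.
(* As [I] lies in [mm], each generator annihilates k, the module presented by [D 0]. *)
have uD k : exists S0, D 0 *m S0 = (u k)%:M.
  apply: (presents_factor Dm); have /idealr_closedP[idI I1] := properI.
  exact: (proper_sub_mm noethA localA idI I1 (generated_mem minu.1 k)).
split=> [pdH|idH].
  have [t ex] := koszul_tor_vanishing resD uD pdH.
  by apply/finite_projdimP; exact: (tor_vanishing_projdim noethA localA resD Dm fgM ex).
have [t ex] := koszul_ext_vanishing resD uD idH.
by apply/finite_injdimP; exact: (ext_vanishing_injdim noethA localA resD Dm fgM ex).
Qed.
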